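(* For nonnegative integers $l,k$, \[ \sum_{n=0}^\infty\frac{Q_l(H_n,\dots,H_n^{(l)})\,P_k(H_n,\dots,H_n^{(k)})}{(n+1)^2}=\binom{l+k+1}{k+1}\zeta(l+k+2)-\sum_{p=k}^{l+k-1}\binom{p}{k}S^R_{l+k+2,\,l+k+1-p}. \]
   Context: For integers $r\ge1$ and $n\ge0$, $H_n^{(r)}=\sum_{t=1}^n t^{-r}$ (so $H_0^{(r)}=0$), $H_n=H_n^{(1)}$. $P_0=Q_0=1$ and for $n\ge1$, $P_n(y_1,\dots,y_n)=\sum_{m_1+2m_2+\cdots=n}\frac{(-1)^{m_2+m_4+\cdots}}{m_1!m_2!\cdots}\prod_{i\ge1}(y_i/i)^{m_i}$, $Q_n(y_1,\dots,y_n)=\sum_{m_1+2m_2+\cdots=n}\frac{1}{m_1!m_2!\cdots}\prod_{i\ge1}(y_i/i)^{m_i}$. Multiple zeta values: $\zeta(a_1,\dots,a_d)=\sum_{n_1>\cdots>n_d\ge1}n_1^{-a_1}\cdots n_d^{-a_d}$ for positive integers with $a_1\ge2$; weight $a_1+\dots+a_d$, depth $d$. $S^R_{N,d}$ denotes the sum of all multiple zeta values of weight $N$ and depth $d$ whose last argument $a_d$ equals $1$. (An empty sum is $0$.) *)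

(* Defs.v *)
From Stdlib Require Import Reals Lra Lia Arith List ClassicalEpsilon.
Import ListNotations.
Open Scope R_scope.

Fixpoint sum1 (N : nat) (f : nat -> R) : R :=
  match N with
  | O => 0
  | S m => sum1 m f + f (S m)
  end.

Definition Hr (n r : nat) : R := sum1 n (fun t => / (INR t ^ r)).

(* Limit of a real sequence (chosen by classical choice; the sequences used
   below are convergent, so this is the usual limit). *)
Definition Rlim (u : nat -> R) : R :=
  epsilon (inhabits 0) (fun l => Un_cv u l).

Fixpoint zeta_trunc (N : nat) (s : list nat) : R :=
  match s with
  | [] => 1
  | a :: s' => sum1 N (fun n => / (INR n ^ a) * zeta_trunc (n - 1) s')
  end.

Definition mzv (s : list nat) : R := Rlim (fun N => zeta_trunc N s).

Fixpoint comps (N d : nat) : list (list nat) :=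
  match d with
  | O => if Nat.eqb N 0 then [[]] else []
  | S d' => flat_map (fun a => map (cons a) (comps (N - a) d')) (seq 1 N)
  end.

Definition SR (N d : nat) : R :=
  fold_right Rplus 0
    (map mzv (filter (fun s => andb (Nat.leb 2 (hd 0%nat s))
                                    (Nat.eqb (last s 0%nat) 1))
                     (comps N d))).

Fixpoint tuples (len bound : nat) : list (list nat) :=
  match len with
  | O => [[]]
  | S m => flat_map (fun x => map (cons x) (tuples m bound)) (seq 0 (S bound))
  end.

Fixpoint wsum (i : nat) (m : list nat) : nat :=
  match m with
  | [] => O
  | x :: s => (i * x + wsum (S i) s)%nat
  end.

Definition mults (n : nat) : list (list nat) :=
  filter (fun m => Nat.eqb (wsum 1 m) n) (tuples n n).

Fixpoint pterm (alt : bool) (i : nat) (y : nat -> R) (m : list nat) : R :=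
  match m with
  | [] => 1
  | x :: s =>
      (if andb alt (Nat.even i) then (-1) ^ x else 1)
      * (y i / INR i) ^ x / INR (fact x) * pterm alt (S i) y s
  end.

Definition Ppoly (n : nat) (y : nat -> R) : R :=
  fold_right Rplus 0 (map (pterm true 1 y) (mults n)).
Definition Qpoly (n : nat) (y : nat -> R) : R :=
  fold_right Rplus 0 (map (pterm false 1 y) (mults n)).

(* Main.v *)
Require Import Defs.
From Stdlib Require Import Reals List.
From Stdlib Require Import Lra Lia ZArith ClassicalEpsilon FunctionalExtensionality.
Open Scope R_scope.

(** At harmonic numbers, P_k is the elementary symmetric polynomial e_k and Q_l the complete
    one h_l in 1, 1/2, ..., 1/n.

    Let s = M+1-p. Comparing the series sum_n (1+r)_(n-1) / (n (s)_n) for s and s+1, their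
    difference telescopes in n to 1/(s(s-r)); summing over M gives
    sum_n h_l(n) e_k(n-1) / n^2 = C(l+k+1,k+1) zeta(l+k+2). Since
    h_l(n-1) = h_l(n) - h_(l-1)(n)/n, the series of the theorem is this value minus
    sum_n h_(l-1)(n) e_k(n-1) / n^3.

    With X f(n) = f(n)/n and Y f(n) = (1/n) sum_(m<n) f(m), the function
    h_(l-1)(n) e_k(n-1) / n is a binomial combination of sums of all words in given numbers
    of letters X and Y, applied to Y delta_0. For the pairing
    <f,g> = sum_(m,n) f(m) g(n) m! n! / (m+n)!, X and Y are adjoint, so the words
    X X w Y become the words X w' Y Y, whose sums are the S^R. *)

(** * Infinite sums of nonnegative terms *)

(** No power series in p and r occurs below: each identity between generating functions is stated
    for the coefficients of p^a r^b, as a recurrence in a and b. These coefficients are nonnegative,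
    so every exchange of infinite sums is an instance of Tonelli.

    Convergence has to be produced on the way, because [mzv] is a chosen limit and carries no
    information about a divergent sequence. The weighted sum formula supplies convergent series;
    they dominate the sums over words; duality transports convergence together with the value;
    nonnegativity hands it down to each single multiple zeta value. Hence sums are relations that
    assert convergence.

    The kernel K(m,n) = m! n! / (m+n)! is chosen for the identity K(m,n)/m = sum_(a>n) K(m,a)/a, m
    >= 1, which trades a division on the left for a strict sum and a division on the right. The
    restriction m >= 1 is the source of the conditions f(0) = 0.

    The binomials in front of S^R are the coefficients in powers of y = p + r. *)

Fixpoint psum (f : nat -> R) (N : nat) : R :=
  match N with
  | O => 0
  | S n => psum f n + f n
  end.

Lemma psum_ext (f g : nat -> R) (N : nat) :
  (forall n, (n < N)%nat -> f n = g n) -> psum f N = psum g N.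
Proof.
  induction N as [|N IH]; intros H; simpl; [reflexivity|].
  rewrite IH by (intros; apply H; lia). rewrite H by lia. reflexivity.
Qed.

Lemma psum_plus (f g : nat -> R) (N : nat) :
  psum (fun n => f n + g n) N = psum f N + psum g N.
Proof. induction N as [|N IH]; simpl; [|rewrite IH]; ring. Qed.

Lemma psum_scal (c : R) (f : nat -> R) (N : nat) :
  psum (fun n => c * f n) N = c * psum f N.
Proof. induction N as [|N IH]; simpl; [|rewrite IH]; ring. Qed.

Lemma psum_zero (N : nat) : psum (fun _ => 0) N = 0.
Proof. induction N as [|N IH]; simpl; [|rewrite IH]; ring. Qed.

Lemma psum_nonneg (f : nat -> R) (N : nat) :
  (forall n, 0 <= f n) -> 0 <= psum f N.
Proof.
  intros H; induction N as [|N IH]; simpl; [lra|specialize (H N); lra].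
Qed.

Lemma psum_le (f g : nat -> R) (N : nat) :
  (forall n, f n <= g n) -> psum f N <= psum g N.
Proof.
  intros H; induction N as [|N IH]; simpl; [lra|specialize (H N); lra].
Qed.

Lemma psum_swap (f : nat -> nat -> R) (M N : nat) :
  psum (fun m => psum (f m) N) M = psum (fun n => psum (fun m => f m n) M) N.
Proof.
  induction M as [|M IH]; simpl.
  - symmetry; apply psum_zero.
  - rewrite IH, <- psum_plus. reflexivity.
Qed.

Lemma psum_head (f : nat -> R) (N : nat) :
  psum f (S N) = f O + psum (fun n => f (S n)) N.
Proof.
  induction N as [|N IH]; simpl in *; [ring|]. rewrite IH. ring.
Qed.

Lemma sum1_psum (N : nat) (f : nat -> R) : sum1 N f = psum (fun n => f (S n)) N.
Proof. induction N as [|N IH]; simpl; [|rewrite IH]; reflexivity. Qed.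

Lemma sum1_psum0 (N : nat) (f : nat -> R) : f O = 0 -> sum1 N f = psum f (S N).
Proof. intros H. rewrite psum_head, H, sum1_psum. ring. Qed.

Lemma sum_f_R0_psum (f : nat -> R) (N : nat) : sum_f_R0 f N = psum f (S N).
Proof. induction N as [|N IH]; simpl in *; [ring|rewrite IH; reflexivity]. Qed.

(** [psum f N] stops before N, so that it is both the partial sum of a series and the strict inner
    sum in [opY] and [zterm]. *)
Definition sums (f : nat -> R) (s : R) : Prop := Un_cv (psum f) s.

Lemma Un_cv_shift1 (u : nat -> R) (l : R) :
  Un_cv (fun n => u (S n)) l <-> Un_cv u l.
Proof.
  split; intros C e He; destruct (C e He) as [N HN].
  - exists (S N). intros [|n] Hn; [lia|]. apply HN. lia.
  - exists N. intros n Hn. apply HN. lia.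
Qed.

Lemma Un_cv_const (c : R) : Un_cv (fun _ => c) c.
Proof. intros e He. exists O. intros. rewrite Rdist_eq. exact He. Qed.

Lemma Un_cv_squeeze0 (u v : nat -> R) :
  (forall n, 0 <= u n <= v n) -> Un_cv v 0 -> Un_cv u 0.
Proof.
  intros H C e He. destruct (C e He) as [N HN]. exists N. intros n Hn.
  specialize (HN n Hn). specialize (H n). unfold Rdist in *.
  rewrite Rminus_0_r in *. rewrite Rabs_pos_eq in * by lra. lra.
Qed.

Lemma sums_ext (f g : nat -> R) (s : R) :
  (forall n, f n = g n) -> sums f s -> sums g s.
Proof.
  intros H. apply Un_cv_ext. intros N. apply psum_ext. auto.
Qed.

Lemma sums_unique (f : nat -> R) (s t : R) : sums f s -> sums f t -> s = t.
Proof. apply UL_sequence. Qed.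

Lemma sums_plus (f g : nat -> R) (s t : R) :
  sums f s -> sums g t -> sums (fun n => f n + g n) (s + t).
Proof.
  intros F G. eapply Un_cv_ext; [|exact (CV_plus _ _ _ _ F G)].
  intros N; simpl. symmetry; apply psum_plus.
Qed.

Lemma sums_scal (c : R) (f : nat -> R) (s : R) :
  sums f s -> sums (fun n => c * f n) (c * s).
Proof.
  intros F. eapply Un_cv_ext; [|exact (CV_mult _ _ _ _ (Un_cv_const c) F)].
  intros N; simpl. symmetry; apply psum_scal.
Qed.

Lemma sums_zero : sums (fun _ => 0) 0.
Proof.
  eapply Un_cv_ext; [|exact (Un_cv_const 0)].
  intros; symmetry; apply psum_zero.
Qed.

Lemma sums_psum (f : nat -> nat -> R) (r : nat -> R) (M : nat) :
  (forall m, (m < M)%nat -> sums (f m) (r m)) ->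
  sums (fun n => psum (fun m => f m n) M) (psum r M).
Proof.
  induction M as [|M IH]; intros H; simpl.
  - apply sums_zero.
  - apply sums_plus; [apply IH; intros; apply H; lia | apply H; lia].
Qed.

Lemma sums_shift1 (f : nat -> R) (s : R) :
  f O = 0 -> sums f s <-> sums (fun n => f (S n)) s.
Proof.
  intros H. unfold sums. rewrite <- (Un_cv_shift1 (psum f)).
  split; apply Un_cv_ext; intros N; rewrite psum_head, H; ring.
Qed.

Lemma psum_growing (f : nat -> R) : (forall n, 0 <= f n) -> Un_growing (psum f).
Proof. intros H n. simpl. specialize (H n). lra. Qed.

Lemma psum_le_sums (f : nat -> R) (s : R) (N : nat) :
  (forall n, 0 <= f n) -> sums f s -> psum f N <= s.
Proof. intros H C. apply growing_ineq; [apply psum_growing, H|exact C]. Qed.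

Lemma sums_bounded (f : nat -> R) (b : R) :
  (forall n, 0 <= f n) -> (forall N, psum f N <= b) -> exists s, sums f s.
Proof.
  intros H B. destruct (Un_cv_crit (psum f)) as [l Hl].
  - apply psum_growing, H.
  - exists b. intros x [n ->]. apply B.
  - exists l. exact Hl.
Qed.

Lemma sums_dominated (f g : nat -> R) (t : R) :
  (forall n, 0 <= f n <= g n) -> sums g t -> exists s, sums f s.
Proof.
  intros H G. apply (sums_bounded f t).
  - intros n; apply H.
  - intros N. apply Rle_trans with (psum g N).
    + apply psum_le. intros; apply H.
    + apply psum_le_sums; [|exact G]. intros n. specialize (H n). lra.
Qed.

Lemma sums_split (f g : nat -> R) (s : R) :
  (forall n, 0 <= f n) -> (forall n, 0 <= g n) ->
  sums (fun n => f n + g n) s ->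
  exists s1 s2, sums f s1 /\ sums g s2 /\ s = s1 + s2.
Proof.
  intros Hf Hg H.
  destruct (sums_dominated f (fun n => f n + g n) s) as [s1 H1]; auto.
  { intros n. specialize (Hf n); specialize (Hg n). lra. }
  destruct (sums_dominated g (fun n => f n + g n) s) as [s2 H2]; auto.
  { intros n. specialize (Hf n); specialize (Hg n). lra. }
  exists s1, s2. split; [|split]; auto.
  apply (sums_unique _ _ _ H), sums_plus; assumption.
Qed.

(** A finite block of rows is summed column by column, and each partial column is at most the full
    one. Applied to an array and to its transpose, this gives equality. *)
Lemma double_sums_le (f : nat -> nat -> R) (r c : nat -> R) (s t : R) :
  (forall m n, 0 <= f m n) ->
  (forall m, sums (f m) (r m)) -> sums r s ->
  (forall n, sums (fun m => f m n) (c n)) -> sums c t -> s <= t.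
Proof.
  intros F R S C T.
  assert (Hc : forall n, 0 <= c n).
  { intros n. apply (psum_le_sums (fun m => f m n) (c n) 0); auto. }
  apply Rle_cv_lim with (psum r) (fun _ => t); [|exact S|apply Un_cv_const].
  intros M.
  apply Rle_cv_lim with (psum (fun n => psum (fun m => f m n) M)) (psum c).
  - intros N. apply psum_le. intros n. apply psum_le_sums; auto.
  - apply (sums_psum f r M). auto.
  - exact T.
Qed.

Lemma tonelli (f : nat -> nat -> R) (r : nat -> R) (s : R) :
  (forall m n, 0 <= f m n) ->
  (forall m, sums (f m) (r m)) -> sums r s ->
  exists c, (forall n, sums (fun m => f m n) (c n)) /\ sums c s.
Proof.
  intros F R S.
  assert (Hr : forall m, 0 <= r m).
  { intros m. apply (psum_le_sums (f m) (r m) 0); auto. }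
  assert (E : forall n, exists cn, sums (fun m => f m n) cn).
  { intros n. apply (sums_dominated _ r s); auto. intros m. split; auto.
    apply Rle_trans with (psum (f m) (Datatypes.S n)).
    - simpl. pose proof (psum_nonneg (f m) n (F m)). lra.
    - apply psum_le_sums; auto. }
  set (c := fun n => proj1_sig (constructive_indefinite_description _ (E n))).
  assert (C : forall n, sums (fun m => f m n) (c n)).
  { intros n. unfold c. apply proj2_sig. }
  assert (Hc : forall n, 0 <= c n).
  { intros n. apply (psum_le_sums (fun m => f m n) (c n) 0); auto. }
  exists c. split; [exact C|].
  destruct (sums_bounded c s) as [t T]; auto.
  { intros N.
    apply Rle_cv_lim with (psum (fun m => psum (f m) N)) (psum r).
    - intros M. apply psum_le. intros m. apply psum_le_sums; auto.
    - apply (sums_psum (fun n m => f m n) c N). auto.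
    - exact S. }
  replace s with t; [exact T|]. apply Rle_antisym.
  - apply (double_sums_le (fun n m => f m n) c r); auto.
  - apply (double_sums_le f r c); auto.
Qed.

(** * A weighted sum formula *)

Lemma INR_S_pos (n : nat) : 0 < INR (S n).
Proof. apply lt_0_INR. lia. Qed.

Definition kern (m n : nat) : R := INR (fact m) * INR (fact n) / INR (fact (m + n)).

Lemma INR_fact_pos (n : nat) : 0 < INR (fact n).
Proof. apply lt_0_INR, lt_O_fact. Qed.

Lemma kern_pos (m n : nat) : 0 < kern m n.
Proof.
  unfold kern. apply Rdiv_lt_0_compat; [|apply INR_fact_pos].
  apply Rmult_lt_0_compat; apply INR_fact_pos.
Qed.

Lemma kern_sym (m n : nat) : kern m n = kern n m.
Proof. unfold kern. rewrite (Nat.add_comm n m). field. apply INR_fact_neq_0. Qed.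

Lemma kern_0_l (n : nat) : kern 0 n = 1.
Proof. unfold kern. simpl. field. apply INR_fact_neq_0. Qed.

Lemma kern_S_r (m n : nat) : kern m (S n) = kern m n * INR (S n) / INR (S (m + n)).
Proof.
  unfold kern. rewrite <- plus_n_Sm, !fact_simpl, !mult_INR. field.
  split; [apply INR_fact_neq_0 | apply not_0_INR; lia].
Qed.

Lemma kern_S_l (m n : nat) : kern (S m) n = kern m n * INR (S m) / INR (S (m + n)).
Proof. rewrite kern_sym, kern_S_r, kern_sym, (Nat.add_comm n m). reflexivity. Qed.

Lemma kern_S_l_le (m n : nat) : kern (S m) n <= / INR (S n).
Proof.
  induction m as [|m IH].
  - rewrite kern_S_l, kern_0_l. simpl plus. right. simpl (INR 1). field.
    apply not_0_INR; lia.
  - rewrite kern_S_l. apply Rle_trans with (kern (S m) n); [|exact IH].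
    pose proof (kern_pos (S m) n).
    apply Rmult_le_reg_r with (INR (S (S m + n))); [apply INR_S_pos|].
    unfold Rdiv. rewrite Rmult_assoc, Rinv_l, Rmult_1_r by (apply not_0_INR; lia).
    apply Rmult_le_compat_l; [lra|]. apply le_INR. lia.
Qed.

Lemma kern_le_1 (m n : nat) : kern m n <= 1.
Proof.
  destruct m as [|m]; [rewrite kern_0_l; lra|].
  apply Rle_trans with (1 := kern_S_l_le m n).
  rewrite <- Rinv_1. apply Rinv_le_contravar; [lra|]. apply (le_INR 1); lia.
Qed.

Lemma Un_cv_inv_S : Un_cv (fun n => / INR (S n)) 0.
Proof.
  intros e He. destruct (archimed_cor1 e He) as [N [HN HN0]].
  exists N. intros n Hn. unfold Rdist. rewrite Rminus_0_r, Rabs_pos_eq.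
  - apply Rle_lt_trans with (/ INR N); [|exact HN].
    apply Rinv_le_contravar; [apply lt_0_INR; lia|]. apply le_INR. lia.
  - apply Rlt_le, Rinv_0_lt_compat, INR_S_pos.
Qed.

(** Multiplication by the variable, on coefficients: if [f n] is the coefficient of p^n in F, this
    is the one in p F. Recurrences written with it cover the index 0. *)
Definition prev (f : nat -> R) (n : nat) : R :=
  match n with
  | O => 0
  | S n' => f n'
  end.

(* [hsym M a n] and [esym b n] are the complete symmetric polynomial h_a in
   1/(M+1), ..., 1/(M+n) and the elementary one e_b in 1, ..., 1/n. *)
Fixpoint hsym (M a : nat) : nat -> R :=
  match a with
  | O => fun _ => 1
  | S a' => psum (fun j => hsym M a' (S j) / INR (M + S j))
  end.

Fixpoint esym (b : nat) : nat -> R :=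
  match b with
  | O => fun _ => 1
  | S b' => psum (fun j => esym b' j / INR (S j))
  end.

Lemma hsym_S (M a n : nat) :
  hsym M a (S n) = hsym M a n + prev (fun a' => hsym M a' (S n)) a / INR (M + S n).
Proof. destruct a; simpl; unfold Rdiv; ring. Qed.

Lemma esym_S (b n : nat) :
  esym b (S n) = esym b n + prev (fun b' => esym b' n) b / INR (S n).
Proof. destruct b; cbn [prev]; [simpl esym; unfold Rdiv; ring|reflexivity]. Qed.

(** Splits off the first variable 1/(M+1), where [hsym_S] splits off the last; this is what compares
    s with s + 1. *)
Lemma hsym_shift (M a n : nat) :
  hsym M a (S n) = hsym (S M) a n + prev (fun a' => hsym M a' (S n)) a / INR (S M).
Proof.
  revert n; induction a as [|a IHa]; intros n; [simpl; unfold Rdiv; ring|].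
  induction n as [|n IHn].
  - cbn [prev]. change (hsym M (S a) 1) with (0 + hsym M a 1 / INR (M + 1)).
    simpl hsym at 2. rewrite Nat.add_1_r. reflexivity.
  - rewrite hsym_S, IHn, (hsym_S (S M) (S a) n). cbn [prev].
    rewrite (hsym_S M a (S n)) at 2. rewrite (IHa (S n)) at 1.
    rewrite (Nat.add_succ_comm M (S n)).
    field. split; apply not_0_INR; lia.
Qed.

Lemma hsym_nonneg (M a n : nat) : 0 <= hsym M a n.
Proof.
  revert n; induction a as [|a IH]; intros n; simpl; [lra|].
  apply psum_nonneg. intros j. rewrite <- plus_n_Sm.
  apply Rmult_le_pos; [apply IH|]. apply Rlt_le, Rinv_0_lt_compat, INR_S_pos.
Qed.

Lemma esym_nonneg (b n : nat) : 0 <= esym b n.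
Proof.
  revert n; induction b as [|b IH]; intros n; simpl; [lra|].
  apply psum_nonneg. intros j.
  apply Rmult_le_pos; [apply IH|]. apply Rlt_le, Rinv_0_lt_compat, INR_S_pos.
Qed.

Lemma hsym_anti (M a n : nat) : hsym M a n <= hsym 0 a n.
Proof.
  revert n; induction a as [|a IH]; intros n; cbn [hsym]; [lra|].
  apply psum_le. intros j. rewrite <- !plus_n_Sm.
  apply Rmult_le_compat; [apply hsym_nonneg| |apply IH|].
  - apply Rlt_le, Rinv_0_lt_compat, INR_S_pos.
  - apply Rinv_le_contravar; [apply INR_S_pos|]. apply le_INR. lia.
Qed.

(* With [s = M+1-p] and rising factorials, [ucoef M n a b] and [dcoef M n a b]
   are the coefficients of [p^a r^b] in [(1+r)_n / (s)_(n+1)] and in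
   [(1+r)_n / (s)_(n+2)]. *)
Definition ucoef (M n a b : nat) : R :=
  esym b n * hsym M a (S n) * kern M n / INR (S (M + n)).

Definition dcoef (M n a b : nat) : R :=
  esym b n * hsym M a (S (S n)) * kern M n / (INR (S (M + n)) * INR (S (S (M + n)))).

Lemma ucoef_nonneg (M n a b : nat) : 0 <= ucoef M n a b.
Proof.
  unfold ucoef. apply Rmult_le_pos.
  - apply Rmult_le_pos; [|apply Rlt_le, kern_pos].
    apply Rmult_le_pos; [apply esym_nonneg|apply hsym_nonneg].
  - apply Rlt_le, Rinv_0_lt_compat, INR_S_pos.
Qed.

Lemma dcoef_nonneg (M n a b : nat) : 0 <= dcoef M n a b.
Proof.
  unfold dcoef. apply Rmult_le_pos.
  - apply Rmult_le_pos; [|apply Rlt_le, kern_pos].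
    apply Rmult_le_pos; [apply esym_nonneg|apply hsym_nonneg].
  - apply Rlt_le, Rinv_0_lt_compat, Rmult_lt_0_compat; apply INR_S_pos.
Qed.

(** With u_n and d_n for the two quotients, this is (s+n+1) d_n = u_n; the [prev] term comes from
    the -p in s. *)
Lemma dcoef_ucoef (M n a b : nat) :
  INR (S (S (M + n))) * dcoef M n a b
  = ucoef M n a b + prev (fun a' => dcoef M n a' b) a.
Proof.
  unfold dcoef, ucoef. rewrite (hsym_S M a (S n)).
  replace (M + S (S n))%nat with (S (S (M + n))) by lia.
  destruct a as [|a]; cbn [prev]; field; split; apply not_0_INR; lia.
Qed.

(** s d_n is u_n with s + 1 in place of s: the first factor of the rising factorial cancels. *)
Lemma dcoef_ucoef_S (M n a b : nat) :
  INR (S M) * dcoef M n a b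
  = ucoef (S M) n a b + prev (fun a' => dcoef M n a' b) a.
Proof.
  unfold dcoef, ucoef. rewrite (hsym_shift M a (S n)), kern_S_l.
  simpl (S M + n)%nat.
  destruct a as [|a]; cbn [prev]; field; repeat split; apply not_0_INR; lia.
Qed.

Lemma dcoef_diff (M n a b : nat) :
  INR (S n) * dcoef M n a b = ucoef M n a b - ucoef (S M) n a b.
Proof.
  pose proof (dcoef_ucoef M n a b) as H1. pose proof (dcoef_ucoef_S M n a b) as H2.
  replace (S (S (M + n))) with (S M + S n)%nat in H1 by lia.
  rewrite plus_INR in H1. lra.
Qed.

Lemma ucoef_S (M n a b : nat) :
  ucoef M (S n) a b = INR (S n) * dcoef M n a b + prev (dcoef M n a) b.
Proof.
  unfold dcoef, ucoef. rewrite esym_S, kern_S_r.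
  replace (M + S n)%nat with (S (M + n)) by lia.
  destruct b as [|b]; cbn [prev]; field; repeat split; apply not_0_INR; lia.
Qed.

(** (s-r) d_n = u_n - u_(n+1), since u_n = (s+n+1) d_n and u_(n+1) = (n+1+r) d_n. *)
Lemma dcoef_telescope (M n a b : nat) :
  INR (S M) * dcoef M n a b
  = prev (fun a' => dcoef M n a' b) a + prev (dcoef M n a) b
    + (ucoef M n a b - ucoef M (S n) a b).
Proof.
  pose proof (dcoef_ucoef M n a b) as H1. pose proof (ucoef_S M n a b) as H2.
  replace (S (S (M + n))) with (S M + S n)%nat in H1 by lia.
  rewrite plus_INR in H1. lra.
Qed.

(** Iterating gives (n+1) u_n <= u_0 + z_0 + ... + z_(n-1), so u_n is bounded by a Cesaro mean of a
    null sequence. *)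
Lemma Un_cv_0_of_recurrence (u z : nat -> R) :
  (forall n, 0 <= u n) -> Un_cv z 0 ->
  (forall n, INR (S (S n)) * u (S n) <= INR (S n) * u n + z n) -> Un_cv u 0.
Proof.
  intros U Z H.
  set (z' := fun n => match n with O => u O | S n' => z n' end).
  assert (Z' : Un_cv z' 0) by (apply Un_cv_shift1; exact Z).
  assert (B : forall n, INR (S n) * u n <= sum_f_R0 z' n).
  { induction n as [|n IH].
    - simpl. lra.
    - simpl sum_f_R0. simpl z'. specialize (H n). lra. }
  apply Cesaro_1 in Z'. apply Un_cv_shift1 in Z'.
  revert Z'. apply Un_cv_squeeze0. intros n. split; [apply U|].
  cbn [Nat.pred]. pose proof (INR_S_pos n).
  apply Rmult_le_reg_l with (INR (S n)); [assumption|].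
  replace (INR (S n) * (sum_f_R0 z' n / INR (S n))) with (sum_f_R0 z' n) by (field; lra).
  apply B.
Qed.

Lemma Un_cv_plus0 (u v : nat -> R) :
  Un_cv u 0 -> Un_cv v 0 -> Un_cv (fun n => u n + v n) 0.
Proof. intros U V. rewrite <- (Rplus_0_l 0). apply CV_plus; assumption. Qed.

Lemma ucoef_recurrence (M n a b : nat) :
  INR (S (S (M + n))) * ucoef M (S n) a b
  = prev (fun a' => ucoef M (S n) a' b) a + INR (S n) * ucoef M n a b
    + prev (ucoef M n a) b.
Proof.
  rewrite ucoef_S, Rmult_plus_distr_l.
  rewrite <- Rmult_assoc, (Rmult_comm _ (INR (S n))), Rmult_assoc, dcoef_ucoef.
  destruct a as [|a]; destruct b as [|b]; cbn [prev]; rewrite ?ucoef_S;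
    cbn [prev]; rewrite ?dcoef_ucoef; cbn [prev]; ring.
Qed.

(** The symmetric polynomials grow like powers of log n. Rather than estimating them, the recurrence
    (s+n+1) u_(n+1) = (n+1+r) u_n reduces the claim to coefficients of lower index. *)
Lemma ucoef_cv_n (M a b : nat) : Un_cv (fun n => ucoef M n a b) 0.
Proof.
  assert (Step : forall a b,
    Un_cv (fun n => prev (fun a' => ucoef M (S n) a' b) a) 0 ->
    Un_cv (fun n => prev (ucoef M n a) b) 0 ->
    Un_cv (fun n => ucoef M n a b) 0).
  { clear a b. intros a b A B.
    apply Un_cv_0_of_recurrence with (2 := Un_cv_plus0 _ _ A B).
    - intros; apply ucoef_nonneg.
    - intros n. apply Rle_trans with (INR (S (S (M + n))) * ucoef M (S n) a b).
      + apply Rmult_le_compat_r; [apply ucoef_nonneg|]. apply le_INR. lia.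
      + rewrite ucoef_recurrence. lra. }
  revert b; induction a as [|a IHa]; intros b; induction b as [|b IHb];
    apply Step; cbn [prev]; try apply Un_cv_const; try assumption;
    apply (Un_cv_shift1 (fun n => ucoef M n _ _)), IHa.
Qed.

Lemma ucoef_cv_M (n a b : nat) : Un_cv (fun M => ucoef M n a b) 0.
Proof.
  apply Un_cv_squeeze0 with (fun M => (esym b n * hsym 0 a (S n)) * / INR (S M)).
  - intros M. split; [apply ucoef_nonneg|]. unfold ucoef, Rdiv.
    pose proof (esym_nonneg b n). pose proof (hsym_nonneg M a (S n)).
    pose proof (hsym_anti M a (S n)). pose proof (kern_pos M n).
    pose proof (kern_le_1 M n).
    apply Rmult_le_compat.
    + apply Rmult_le_pos; [apply Rmult_le_pos; assumption|lra].
    + apply Rlt_le, Rinv_0_lt_compat, INR_S_pos.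
    + rewrite <- (Rmult_1_r (esym b n * hsym 0 a (S n))).
      apply Rmult_le_compat; [apply Rmult_le_pos; assumption|lra| |assumption].
      apply Rmult_le_compat_l; assumption.
    + apply Rinv_le_contravar; [apply INR_S_pos|]. apply le_INR. lia.
  - rewrite <- (Rmult_0_r (esym b n * hsym 0 a (S n))).
    apply CV_mult; [apply Un_cv_const|apply Un_cv_inv_S].
Qed.

Lemma sums_telescope (u : nat -> R) :
  Un_cv u 0 -> sums (fun n => u n - u (S n)) (u O).
Proof.
  intros U. apply Un_cv_shift1 in U.
  apply Un_cv_shift1. apply Un_cv_ext with (fun N => u O - u (S N)).
  - intros N. induction N as [|N IH]; simpl in *; [ring|]. rewrite <- IH. ring.
  - pose proof (CV_minus _ _ _ _ (Un_cv_const (u O)) U) as C.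
    rewrite Rminus_0_r in C. exact C.
Qed.

Lemma binom_n_n (n : nat) : Binomial.C n n = 1.
Proof. unfold Binomial.C. rewrite Nat.sub_diag. simpl. field. apply INR_fact_neq_0. Qed.

Lemma binom_0_r (n : nat) : Binomial.C n 0 = 1.
Proof. unfold Binomial.C. rewrite Nat.sub_0_r. simpl. field. apply INR_fact_neq_0. Qed.

Lemma sums_prev (f : nat -> nat -> R) (s : nat -> R) (a : nat) :
  (forall a', a = S a' -> sums (f a') (s a')) ->
  sums (fun n => prev (fun a' => f a' n) a) (prev s a).
Proof. destruct a as [|a]; intros H; simpl; [apply sums_zero|apply H; reflexivity]. Qed.

Lemma ucoef_0_0 (M a : nat) : ucoef M 0 a 0 = / INR (S M) ^ (S a).
Proof.
  assert (U : hsym M a 1 = / INR (S M) ^ a).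
  { induction a as [|a IH]; [simpl; field|].
    rewrite hsym_S. cbn [prev]. rewrite IH, Nat.add_1_r. cbn [hsym psum pow].
    pose proof (INR_S_pos M). field. split; [apply pow_nonzero|]; lra. }
  unfold ucoef. rewrite U, kern_sym, kern_0_l, Nat.add_0_r. cbn [esym pow].
  pose proof (INR_S_pos M). field. split; [apply pow_nonzero|]; lra.
Qed.

Lemma ucoef_0_S (M a b : nat) : ucoef M 0 a (S b) = 0.
Proof. unfold ucoef. simpl esym. unfold Rdiv. ring. Qed.

(** The value is the coefficient of p^a r^b in 1/(s(s-r)) = sum_b r^b / s^(b+2). The telescoping
    relation gives it by Pascal's rule; its boundary term u_0 = 1/s enters only for b = 0. *)
Lemma sums_dcoef (M a b : nat) :
  sums (fun n => dcoef M n a b)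
    (Binomial.C (a + b + 1) (b + 1) / INR (S M) ^ (a + b + 2)).
Proof.
  set (s := fun a b => Binomial.C (a + b + 1) (b + 1) / INR (S M) ^ (a + b + 2)).
  change (sums (fun n => dcoef M n a b) (s a b)).
  pose proof (INR_S_pos M) as HM.
  assert (Step : forall a b,
    (forall a', a = S a' -> sums (fun n => dcoef M n a' b) (s a' b)) ->
    (forall b', b = S b' -> sums (fun n => dcoef M n a b') (s a b')) ->
    sums (fun n => dcoef M n a b)
      (/ INR (S M) * (prev (fun a' => s a' b) a + prev (s a) b + ucoef M 0 a b))).
  { clear a b. intros a b A B.
    apply sums_ext with (fun n => / INR (S M) *
      (prev (fun a' => dcoef M n a' b) a + prev (dcoef M n a) b
       + (ucoef M n a b - ucoef M (S n) a b))).
    { intros n. rewrite <- dcoef_telescope. field. lra. }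
    apply sums_scal. apply sums_plus; [apply sums_plus|].
    - apply (sums_prev (fun a' n => dcoef M n a' b) (fun a' => s a' b)). exact A.
    - apply (sums_prev (fun b' n => dcoef M n a b') (s a)). exact B.
    - apply (sums_telescope (fun n => ucoef M n a b)), ucoef_cv_n. }
  revert b; induction a as [|a IHa]; intros b; induction b as [|b IHb];
    (eapply eq_ind; [apply Step; [intros a' [= <-]; apply IHa|intros b' [= <-]; exact IHb]
                    |cbn [prev]; unfold s; rewrite ?ucoef_0_0, ?ucoef_0_S;
                     remember (INR (S M)) as x eqn:Ex; clear Ex]).
  - simpl plus. rewrite binom_n_n. simpl. field. lra.
  - simpl plus. rewrite !binom_n_n. rewrite <- plus_n_Sm. simpl pow.
    field. split; [apply pow_nonzero|]; lra.
  - replace (S a + 0 + 1)%nat with (S (a + 0 + 1)) by lia.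
    change (0 + 1)%nat with 1%nat. rewrite <- pascal, binom_0_r by lia.
    replace (S a + 0 + 2)%nat with (S (a + 2)) by lia.
    replace (a + 0 + 2)%nat with (a + 2)%nat by lia.
    replace (S (S a)) with (a + 2)%nat by lia. simpl pow.
    field. split; [apply pow_nonzero|]; lra.
  - replace (S a + S b + 1)%nat with (S (S a + b + 1)) by lia.
    replace (S b + 1)%nat with (S (b + 1)) by lia.
    rewrite <- pascal by lia.
    replace (a + S b + 1)%nat with (S a + b + 1)%nat by lia.
    replace (S a + S b + 2)%nat with (S (S a + b + 2)) by lia.
    replace (a + S b + 2)%nat with (S a + b + 2)%nat by lia.
    remember (S a + b + 2)%nat as N. simpl pow.
    field. split; [apply pow_nonzero|]; lra.
Qed.

(** The double series of [dcoef] in both orders: over n by [sums_dcoef], over M by telescoping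
    [dcoef_diff], which leaves the term M = 0. *)
Lemma sums_ucoef (a b : nat) (s : R) :
  sums (fun M => Binomial.C (a + b + 1) (b + 1) / INR (S M) ^ (a + b + 2)) s ->
  sums (fun n => ucoef 0 n a b / INR (S n)) s.
Proof.
  intros H.
  destruct (tonelli (fun M n => dcoef M n a b) _ s (fun M n => dcoef_nonneg M n a b)
              (fun M => sums_dcoef M a b) H) as [c [C S]].
  revert S. apply sums_ext. intros n. apply (sums_unique _ _ _ (C n)).
  apply sums_ext with (fun M => / INR (S n) * (ucoef M n a b - ucoef (S M) n a b)).
  - intros M. rewrite <- dcoef_diff. pose proof (INR_S_pos n). field. lra.
  - unfold Rdiv. rewrite Rmult_comm. apply sums_scal.
    apply (sums_telescope (fun M => ucoef M n a b)), ucoef_cv_M.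
Qed.

(** * Duality *)

(** As [/ 0] is 0, the result vanishes at 0, as adjointness will require; [opY] vanishes there as an
    empty sum. *)
Definition opX (f : nat -> R) (n : nat) : R := f n / INR n.
Definition opY (f : nat -> R) (n : nat) : R := psum f n / INR n.
Definition fadd (f g : nat -> R) (n : nat) : R := f n + g n.

Lemma opX_fadd (f g : nat -> R) : opX (fadd f g) = fadd (opX f) (opX g).
Proof. extensionality n. unfold opX, fadd, Rdiv. ring. Qed.

Lemma opY_fadd (f g : nat -> R) : opY (fadd f g) = fadd (opY f) (opY g).
Proof. extensionality n. unfold opY, fadd, Rdiv. rewrite psum_plus. ring. Qed.

Lemma inv_INR_nonneg (n : nat) : 0 <= / INR n.
Proof.
  destruct n as [|n]; [simpl; rewrite Rinv_0; lra|].
  apply Rlt_le, Rinv_0_lt_compat, INR_S_pos.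
Qed.

Lemma opX_nonneg (f : nat -> R) (n : nat) : (forall n, 0 <= f n) -> 0 <= opX f n.
Proof. intros F. apply Rmult_le_pos; [apply F|apply inv_INR_nonneg]. Qed.

Lemma opY_nonneg (f : nat -> R) (n : nat) : (forall n, 0 <= f n) -> 0 <= opY f n.
Proof. intros F. apply Rmult_le_pos; [apply psum_nonneg, F|apply inv_INR_nonneg]. Qed.

Lemma opX_0 (f : nat -> R) : opX f O = 0.
Proof. unfold opX. simpl. unfold Rdiv. rewrite Rinv_0. ring. Qed.

Lemma opY_0 (f : nat -> R) : opY f O = 0.
Proof. unfold opY. simpl. unfold Rdiv. ring. Qed.

(* [words a b f] is the sum, over all words in [a] letters X and [b] letters Y,
   of the corresponding composites of [opX] and [opY] applied to [f]. *)
Fixpoint words (a : nat) : nat -> (nat -> R) -> nat -> R :=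
  match a with
  | O => fix words0 (b : nat) (f : nat -> R) : nat -> R :=
      match b with
      | O => f
      | S b' => opY (words0 b' f)
      end
  | S a' => fix wordsS (b : nat) (f : nat -> R) : nat -> R :=
      match b with
      | O => opX (words a' O f)
      | S b' => fadd (opX (words a' (S b') f)) (opY (wordsS b' f))
      end
  end.

Lemma words_00 (f : nat -> R) : words 0 0 f = f.
Proof. reflexivity. Qed.
Lemma words_0S (b : nat) (f : nat -> R) : words 0 (S b) f = opY (words 0 b f).
Proof. reflexivity. Qed.
Lemma words_S0 (a : nat) (f : nat -> R) : words (S a) 0 f = opX (words a 0 f).
Proof. reflexivity. Qed.
Lemma words_SS (a b : nat) (f : nat -> R) :
  words (S a) (S b) f = fadd (opX (words a (S b) f)) (opY (words (S a) b f)).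
Proof. reflexivity. Qed.
Global Opaque words.

Lemma words_0S_r (b : nat) (f : nat -> R) : words 0 (S b) f = words 0 b (opY f).
Proof.
  induction b as [|b IH]; [reflexivity|].
  rewrite words_0S, IH, words_0S. reflexivity.
Qed.

Lemma words_S0_r (a : nat) (f : nat -> R) : words (S a) 0 f = words a 0 (opX f).
Proof.
  induction a as [|a IH]; [reflexivity|].
  rewrite words_S0, IH, words_S0. reflexivity.
Qed.

(** The definition peels off the outermost letter, this the innermost: a letter moved across the
    pairing leaves one word at its outer end and enters the other at its inner end. *)
Lemma words_SS_r (a b : nat) (f : nat -> R) :
  words (S a) (S b) f = fadd (words a (S b) (opX f)) (words (S a) b (opY f)).
Proof.
  assert (swap4 : forall p q r s : nat -> R,
    fadd (fadd p q) (fadd r s) = fadd (fadd p r) (fadd q s)).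
  { intros. extensionality n. unfold fadd. ring. }
  revert b; induction a as [|a IHa]; intros b; induction b as [|b IHb];
    rewrite words_SS.
  - rewrite !words_0S, !words_S0, !words_00.
    extensionality n. unfold fadd. ring.
  - rewrite IHb, (words_0S_r (S b) f), opY_fadd, words_SS, (words_0S (S b) (opX f)).
    extensionality n. unfold fadd. ring.
  - rewrite IHa, (words_S0_r (S a) f), opX_fadd, words_SS, (words_S0 (S a) (opY f)).
    extensionality n. unfold fadd. ring.
  - rewrite IHa, IHb, opX_fadd, opY_fadd, swap4, <- !words_SS. reflexivity.
Qed.

Lemma words_nonneg (a b : nat) (f : nat -> R) :
  (forall n, 0 <= f n) -> forall n, 0 <= words a b f n.
Proof.
  intros F. revert b; induction a as [|a IHa]; intros b; induction b as [|b IHb]; intros n.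
  - apply F.
  - rewrite words_0S. apply opY_nonneg, IHb.
  - rewrite words_S0. apply opX_nonneg, IHa.
  - rewrite words_SS. apply Rplus_le_le_0_compat.
    + apply opX_nonneg, IHa.
    + apply opY_nonneg, IHb.
Qed.

Lemma words_0 (a b : nat) (f : nat -> R) : f O = 0 -> words a b f O = 0.
Proof.
  intros F. destruct a as [|a], b as [|b].
  - exact F.
  - rewrite words_0S. apply opY_0.
  - rewrite words_S0. apply opX_0.
  - rewrite words_SS. unfold fadd. rewrite opX_0, opY_0. ring.
Qed.

(** An iterated sum, rows first; for nonnegative functions [tonelli] makes the order immaterial. *)
Definition pairing (f g : nat -> R) (s : R) : Prop :=
  exists r, (forall m, sums (fun n => f m * kern m n * g n) (r m)) /\ sums r s.

Lemma pairing_nonneg (f g : nat -> R) :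
  (forall n, 0 <= f n) -> (forall n, 0 <= g n) ->
  forall m n, 0 <= f m * kern m n * g n.
Proof.
  intros F G m n. pose proof (kern_pos m n).
  apply Rmult_le_pos; [apply Rmult_le_pos|]; auto. lra.
Qed.

Lemma pairing_sym (f g : nat -> R) (s : R) :
  (forall n, 0 <= f n) -> (forall n, 0 <= g n) ->
  pairing f g s -> pairing g f s.
Proof.
  intros F G [r [R S]].
  destruct (tonelli _ r s (pairing_nonneg f g F G) R S) as [c [C T]].
  exists c. split; [|exact T]. intros n. specialize (C n). revert C.
  apply sums_ext. intros m. rewrite kern_sym. ring.
Qed.

Lemma kern_cv_0 (m : nat) : Un_cv (kern (S m)) 0.
Proof.
  apply Un_cv_squeeze0 with (2 := Un_cv_inv_S).
  intros n. split; [apply Rlt_le, kern_pos|apply kern_S_l_le].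
Qed.

Lemma sums_kern_tail (m n : nat) :
  sums (fun a => if (n <? a)%nat then kern (S m) a / INR a else 0)
       (kern (S m) n / INR (S m)).
Proof.
  (* Constant up to a = n, so the series cut off at a > n telescopes from index 0. *)
  set (u := fun a => if (n <? a)%nat then kern (S m) a else kern (S m) n).
  assert (D : forall a, (if (n <? S a)%nat then kern (S m) (S a) / INR (S a) else 0)
                        = / INR (S m) * (u a - u (S a))).
  { intros a. unfold u. pose proof (INR_S_pos m). pose proof (INR_S_pos a).
    pose proof (INR_S_pos (S m + a)).
    assert (E : kern (S m) (S a) / INR (S a)
                = / INR (S m) * (kern (S m) a - kern (S m) (S a))).
    { rewrite kern_S_r.
      replace (S (S m + a)) with (S m + S a)%nat in * by lia.
      rewrite plus_INR in *. field. lra. }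
    destruct (Nat.ltb_spec n a); destruct (Nat.ltb_spec n (S a)); try lia.
    - exact E.
    - replace n with a by lia. exact E.
    - ring. }
  apply sums_shift1; [reflexivity|].
  apply sums_ext with (fun a => / INR (S m) * (u a - u (S a))).
  { intros a. symmetry. apply D. }
  replace (kern (S m) n / INR (S m)) with (/ INR (S m) * u O).
  - apply sums_scal, sums_telescope.
    apply (CV_shift u (S n)), Un_cv_ext with (fun a => kern (S m) (a + S n)).
    + intros a. unfold u. destruct (Nat.ltb_spec n (a + S n)); [reflexivity|lia].
    + apply (CV_shift' (kern (S m)) (S n)), kern_cv_0.
  - unfold u. destruct (Nat.ltb_spec n 0); [lia|]. unfold Rdiv. ring.
Qed.

Lemma psum_indicator (g : nat -> R) (a N : nat) :
  psum (fun n => if (n <? a)%nat then g n else 0) N = psum g (Nat.min a N).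
Proof.
  induction N as [|N IH]; simpl; [rewrite Nat.min_0_r; reflexivity|].
  rewrite IH. destruct (Nat.ltb_spec N a).
  - rewrite !Nat.min_r by lia. reflexivity.
  - rewrite !Nat.min_l by lia. ring.
Qed.

Lemma sums_indicator (g : nat -> R) (a : nat) :
  sums (fun n => if (n <? a)%nat then g n else 0) (psum g a).
Proof.
  apply (CV_shift _ a), Un_cv_ext with (fun _ => psum g a); [|apply Un_cv_const].
  intros N. rewrite psum_indicator, Nat.min_l by lia. reflexivity.
Qed.

(* Applied letter by letter, this is the duality of multiple zeta values. *)
Lemma pairing_opX_opY (f g : nat -> R) (s : R) :
  (forall n, 0 <= f n) -> (forall n, 0 <= g n) -> f O = 0 ->
  pairing (opX f) g s <-> pairing f (opY g) s.
Proof.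
  intros F G F0.
  (* Summed over a > n this puts X on f, by the tail identity; summed over n < a it puts Y on g. *)
  set (h := fun m n a => f m * g n * (if (n <? a)%nat then kern m a / INR a else 0)).
  assert (H : forall m n a, 0 <= h m n a).
  { intros m n a. unfold h. apply Rmult_le_pos; [apply Rmult_le_pos; auto|].
    destruct (n <? a)%nat; [|lra].
    apply Rmult_le_pos; [apply Rlt_le, kern_pos|apply inv_INR_nonneg]. }
  assert (R : forall m n, sums (h m n) (opX f m * kern m n * g n)).
  { intros [|m] n.
    (* For m = 0 the tail is that of the harmonic series and diverges; f(0) = 0 removes this row. *)
    - rewrite opX_0, !Rmult_0_l. apply sums_ext with (2 := sums_zero).
      intros a. unfold h. rewrite F0. ring.
    - replace (opX f (S m) * kern (S m) n * g n)
        with (f (S m) * g n * (kern (S m) n / INR (S m)))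
        by (unfold opX, Rdiv; ring).
      apply sums_scal, sums_kern_tail. }
  assert (C : forall m a, sums (fun n => h m n a) (f m * kern m a * opY g a)).
  { intros m a. apply sums_ext with
      (fun n => f m * kern m a / INR a * (if (n <? a)%nat then g n else 0)).
    - intros n. unfold h, Rdiv. destruct (n <? a)%nat; ring.
    - unfold opY, Rdiv. rewrite (Rmult_comm (psum g a)), <- Rmult_assoc.
      apply sums_scal, sums_indicator. }
  split; intros [r [Hr Hs]]; exists r; (split; [|exact Hs]); intros m.
  - destruct (tonelli (h m) _ (r m) (H m) (R m) (Hr m)) as [c [Hc Hc']].
    revert Hc'. apply sums_ext. intros a. exact (sums_unique _ _ _ (Hc a) (C m a)).
  - destruct (tonelli (fun a n => h m n a) _ (r m) (fun a n => H m n a) (C m) (Hr m))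
      as [c [Hc Hc']].
    revert Hc'. apply sums_ext. intros n. exact (sums_unique _ _ _ (Hc n) (R m n)).
Qed.

Lemma pairing_opY_opX (f g : nat -> R) (s : R) :
  (forall n, 0 <= f n) -> (forall n, 0 <= g n) -> g O = 0 ->
  pairing (opY f) g s -> pairing f (opX g) s.
Proof.
  intros F G G0 P.
  apply pairing_sym; [intros; apply opX_nonneg; auto|auto|].
  apply pairing_opX_opY; auto.
  apply pairing_sym; auto. intros; apply opY_nonneg; auto.
Qed.

Lemma pairing_fadd_l (f f' g : nat -> R) (s : R) :
  (forall n, 0 <= f n) -> (forall n, 0 <= f' n) -> (forall n, 0 <= g n) ->
  pairing (fadd f f') g s ->
  exists s1 s2, pairing f g s1 /\ pairing f' g s2 /\ s = s1 + s2.
Proof.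
  intros F F' G [r [Hr Hs]].
  assert (E : forall m, exists p : R * R,
    sums (fun n => f m * kern m n * g n) (fst p) /\
    sums (fun n => f' m * kern m n * g n) (snd p) /\ r m = fst p + snd p).
  { intros m. destruct (sums_split (fun n => f m * kern m n * g n)
      (fun n => f' m * kern m n * g n) (r m)) as [s1 [s2 [H1 [H2 H3]]]].
    - apply pairing_nonneg; auto.
    - apply pairing_nonneg; auto.
    - specialize (Hr m). revert Hr. apply sums_ext. intros n. unfold fadd. ring.
    - exists (s1, s2). auto. }
  set (p := fun m => proj1_sig (constructive_indefinite_description _ (E m))).
  assert (P : forall m,
    sums (fun n => f m * kern m n * g n) (fst (p m)) /\
    sums (fun n => f' m * kern m n * g n) (snd (p m)) /\ r m = fst (p m) + snd (p m)).
  { intros m. unfold p. apply proj2_sig. }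
  destruct (sums_split (fun m => fst (p m)) (fun m => snd (p m)) s)
    as [s1 [s2 [H1 [H2 H3]]]].
  - intros m. apply (psum_le_sums (fun n => f m * kern m n * g n) _ 0);
      [apply pairing_nonneg; auto|apply P].
  - intros m. apply (psum_le_sums (fun n => f' m * kern m n * g n) _ 0);
      [apply pairing_nonneg; auto|apply P].
  - revert Hs. apply sums_ext. intros m. apply P.
  - exists s1, s2. split; [|split; [|exact H3]].
    + exists (fun m => fst (p m)). split; [apply P|exact H1].
    + exists (fun m => snd (p m)). split; [apply P|exact H2].
Qed.

Lemma pairing_fadd_r (f g g' : nat -> R) (s1 s2 : R) :
  pairing f g s1 -> pairing f g' s2 -> pairing f (fadd g g') (s1 + s2).
Proof.
  intros [r1 [R1 S1]] [r2 [R2 S2]]. exists (fun m => r1 m + r2 m).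
  split; [|apply sums_plus; assumption].
  intros m. apply sums_ext with (fun n => f m * kern m n * g n + f m * kern m n * g' n).
  - intros n. unfold fadd. ring.
  - apply sums_plus; auto.
Qed.

(** Adjunction reverses a word and exchanges X with Y. Reversal permutes the words with given letter
    counts, so only the counts are swapped. *)
Lemma pairing_words (a b : nat) (f g : nat -> R) (s : R) :
  (forall n, 0 <= f n) -> (forall n, 0 <= g n) -> f O = 0 -> g O = 0 ->
  pairing (words a b f) g s -> pairing f (words b a g) s.
Proof.
  intros F G F0 G0.
  assert (W : forall a b n, 0 <= words a b f n) by (intros; apply words_nonneg, F).
  assert (W0 : forall a b, words a b f O = 0) by (intros; apply words_0, F0).
  revert b g s G G0; induction a as [|a IHa]; intros b; induction b as [|b IHb];
    intros g s G G0 P.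
  - exact P.
  - rewrite words_S0_r. apply IHb; [intros; apply opX_nonneg, G|apply opX_0|].
    apply pairing_opY_opX; auto.
  - rewrite words_0S_r. apply IHa; [intros; apply opY_nonneg, G|apply opY_0|].
    apply pairing_opX_opY; auto.
  - rewrite words_SS in P. apply pairing_fadd_l in P as [s1 [s2 [P1 [P2 ->]]]]; auto.
    + rewrite words_SS_r, Rplus_comm. apply pairing_fadd_r.
      * apply IHb; [intros; apply opX_nonneg, G|apply opX_0|].
        apply pairing_opY_opX; auto.
      * apply IHa; [intros; apply opY_nonneg, G|apply opY_0|].
        apply pairing_opX_opY; auto.
    + intros; apply opX_nonneg; auto.
    + intros; apply opY_nonneg; auto.
Qed.

Definition delta0 (n : nat) : R := match n with O => 1 | S _ => 0 end.

Lemma delta0_nonneg (n : nat) : 0 <= delta0 n.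
Proof. destruct n; simpl; lra. Qed.

Lemma sums_delta0 (c : nat -> R) : sums (fun n => c n * delta0 n) (c O).
Proof.
  apply Un_cv_shift1, Un_cv_ext with (fun _ => c O); [|apply Un_cv_const].
  intros N. induction N as [|N IH]; simpl in *; [ring|]. rewrite <- IH. ring.
Qed.

Lemma pairing_delta0_r (f : nat -> R) (s : R) : pairing f delta0 s <-> sums f s.
Proof.
  assert (D : forall m, sums (fun n => f m * kern m n * delta0 n) (f m)).
  { intros m. pose proof (sums_delta0 (fun n => f m * kern m n)) as H.
    cbn beta in H. rewrite (kern_sym m 0), kern_0_l, Rmult_1_r in H. exact H. }
  split.
  - intros [r [Hr Hs]]. revert Hs. apply sums_ext. intros m.
    exact (sums_unique _ _ _ (Hr m) (D m)).
  - intros H. exists f. split; assumption.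
Qed.

(** With d = delta_0, the sum is <X X w Y d, d> because K(m,0) = 1. It becomes <X w Y d, Y d>, <w Y
    d, Y Y d>, <Y d, w' Y Y d>, <d, X w' Y Y d>. Each move asks only the function under X to vanish
    at 0, so d may stand on the other side. *)
Lemma words_duality (a b : nat) (s : R) :
  sums (opX (opX (words a b (opY delta0)))) s ->
  sums (opX (words b a (opY (opY delta0)))) s.
Proof.
  intros H.
  pose proof delta0_nonneg as D.
  assert (D1 : forall n, 0 <= opY delta0 n) by (intros; apply opY_nonneg, D).
  assert (D2 : forall n, 0 <= opY (opY delta0) n) by (intros; apply opY_nonneg, D1).
  assert (W : forall n, 0 <= words a b (opY delta0) n) by (intros; apply words_nonneg, D1).
  apply pairing_delta0_r in H.
  apply (proj1 (pairing_opX_opY _ _ _ (fun n => opX_nonneg _ n W) D (opX_0 _))) in H.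
  apply (proj1 (pairing_opX_opY _ _ _ W D1 (words_0 _ _ _ (opY_0 _)))) in H.
  apply pairing_words in H; [|exact D1|exact D2|apply opY_0|apply opY_0].
  apply pairing_opY_opX in H;
    [|exact D|intros; apply words_nonneg, D2|apply words_0, opY_0].
  apply pairing_delta0_r, pairing_sym; auto.
  intros; apply opX_nonneg, words_nonneg, D2.
Qed.

(* [vterm a b] at [n] is the coefficient of [p^a r^b] in
   [1/(n-p)] times the product of [(j+r)/(j-p)] over [1 <= j < n], which is the generating
   function of [words] at [x = p], [y = p + r]. *)
Definition vterm (a b n : nat) : R :=
  match n with
  | O => 0
  | S n' => esym b n' * hsym 0 a (S n') / INR (S n')
  end.

Definition vinit (a b : nat) : nat -> R :=
  match a, b with
  | O, O => delta0
  | _, _ => fun _ => 0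
  end.

(** Let P_n be the product of (j+r)/(j-p) over j <= n. Since (n+r)/(n-p) - 1 = (p+r)/(n-p), the
    increment P_n - P_(n-1) is p + r times the function of [vterm]; [vinit] is P_0 = 1. *)
Lemma esym_hsym_psum (a b n : nat) :
  esym b n * hsym 0 a n
  = psum (fun m => vinit a b m + prev (fun a' => vterm a' b m) a
                   + prev (fun b' => vterm a b' m) b) (S n).
Proof.
  induction n as [|n IH].
  - destruct a as [|a], b as [|b]; simpl; ring.
  - remember (S n) as m eqn:Em. cbn [psum]. rewrite <- IH. subst m.
    rewrite esym_S.
    replace (hsym 0 a n)
      with (hsym 0 a (S n) - prev (fun a' => hsym 0 a' (S n)) a / INR (S n))
      by (rewrite (hsym_S 0 a n); simpl (0 + S n)%nat; ring).
    pose proof (INR_S_pos n).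
    replace (vinit a b (S n)) with 0 by (destruct a, b; reflexivity).
    destruct a as [|a], b as [|b]; cbn [prev vterm]; field; lra.
Qed.

(** For the generating function V of [vterm], n V(n) = p V(n) + P_(n-1), that is V = p X V + Y
    (delta_0 + (p+r) V). *)
Lemma vterm_rec (a b n : nat) :
  vterm a b n
  = opX (fun m => prev (fun a' => vterm a' b m) a) n
    + opY (fun m => vinit a b m + prev (fun a' => vterm a' b m) a
                    + prev (fun b' => vterm a b' m) b) n.
Proof.
  destruct n as [|n].
  - rewrite opX_0, opY_0. simpl. ring.
  - unfold opX, opY. rewrite <- esym_hsym_psum. cbn [vterm].
    rewrite (hsym_S 0 a n). simpl (0 + S n)%nat. pose proof (INR_S_pos n).
    destruct a as [|a]; cbn [prev vterm]; field; lra.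
Qed.

Lemma opX_psum (c : nat -> R) (f : nat -> nat -> R) (N n : nat) :
  opX (fun m => psum (fun i => c i * f i m) N) n = psum (fun i => c i * opX (f i) n) N.
Proof.
  unfold opX, Rdiv. rewrite Rmult_comm, <- psum_scal.
  apply psum_ext. intros. ring.
Qed.

Lemma opY_psum (c : nat -> R) (f : nat -> nat -> R) (N n : nat) :
  opY (fun m => psum (fun i => c i * f i m) N) n = psum (fun i => c i * opY (f i) n) N.
Proof.
  unfold opY, Rdiv.
  rewrite (psum_swap (fun m i => c i * f i m)), Rmult_comm, <- psum_scal.
  apply psum_ext. intros. rewrite psum_scal. ring.
Qed.

Lemma opY_ext (f g : nat -> R) (n : nat) : (forall m, f m = g m) -> opY f n = opY g n.
Proof. intros H. unfold opY. f_equal. apply psum_ext. auto. Qed.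

Lemma opX_ext (f g : nat -> R) (n : nat) : (forall m, f m = g m) -> opX f n = opX g n.
Proof. intros H. unfold opX. rewrite H. reflexivity. Qed.

(** The coefficient of p^a r^k in the sum of x^i y^j [words i j f] at x = p, y = p + r: the power
    y^(k+i) contributes C(k+i,k) p^i r^k. *)
Definition wcomb (f : nat -> R) (a k n : nat) : R :=
  psum (fun i => Binomial.C (k + i) k * words (a - i) (k + i) f n) (S a).

Lemma words_Sl (a b : nat) (f : nat -> R) (n : nat) :
  words (S a) b f n
  = opX (words a b f) n + opY (fun m => prev (fun b' => words (S a) b' f m) b) n.
Proof.
  destruct b as [|b]; [|rewrite words_SS; reflexivity].
  rewrite words_S0. cbn [prev]. unfold opY. rewrite psum_zero. unfold Rdiv. ring.
Qed.

Lemma binom_hook (k i : nat) :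
  Binomial.C (k + S i) k
  = Binomial.C (k + i) k + prev (fun k' => Binomial.C (k' + S i) k') k.
Proof.
  destruct k as [|k]; cbn [prev].
  - rewrite !binom_0_r. ring.
  - change (S k + S i)%nat with (S (k + S i)). rewrite <- pascal by lia.
    rewrite Nat.add_succ_comm. ring.
Qed.

Lemma wcomb_0 (f : nat -> R) (k n : nat) : wcomb f 0 k n = words 0 k f n.
Proof. unfold wcomb. cbn [psum]. rewrite <- plus_n_O, binom_n_n. simpl. ring. Qed.

(** An outermost X carries p. An outermost Y carries p + r, and Pascal's rule in [binom_hook]
    separates its two shares. *)
Lemma wcomb_S (f : nat -> R) (a k n : nat) :
  wcomb f (S a) k n
  = opX (wcomb f a k) n
    + opY (fun m => wcomb f a k m + prev (fun k' => wcomb f (S a) k' m) k) n.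
Proof.
  transitivity
    (psum (fun i => Binomial.C (k + i) k * opX (words (a - i) (k + i) f) n) (S a)
     + psum (fun i => Binomial.C (k + i) k
               * opY (fun m => prev (fun b => words (S a - i) b f m) (k + i)) n) (S (S a))).
  { unfold wcomb. remember (S a) as a' eqn:Ea. cbn [psum].
    rewrite <- Rplus_assoc, <- psum_plus. f_equal.
    - apply psum_ext. intros i Hi. replace (a' - i)%nat with (S (a - i)) by lia.
      rewrite words_Sl. ring.
    - rewrite Nat.sub_diag. replace (k + a')%nat with (S (k + a)) by lia.
      rewrite words_0S. reflexivity. }
  f_equal; [unfold wcomb at 1; rewrite opX_psum; reflexivity|].
  change (fun m => wcomb f a k m + prev (fun k' => wcomb f (S a) k' m) k)
    with (fadd (wcomb f a k) (fun m => prev (fun k' => wcomb f (S a) k' m) k)).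
  rewrite opY_fadd. unfold fadd at 1.
  rewrite psum_head.
  rewrite (psum_ext _ (fun i => Binomial.C (k + i) k * opY (words (a - i) (k + i) f) n
     + prev (fun k' => Binomial.C (k' + S i) k') k * opY (words (a - i) (k + i) f) n)).
  2:{ intros i Hi. rewrite binom_hook, <- plus_n_Sm. cbn [prev Nat.sub].
      change (fun m => words (a - i) (k + i) f m) with (words (a - i) (k + i) f). ring. }
  rewrite psum_plus. unfold wcomb at 1. rewrite opY_psum.
  change (fun i => Binomial.C (k + i) k * opY (fun m => words (a - i) (k + i) f m) n)
    with (fun i => Binomial.C (k + i) k * opY (words (a - i) (k + i) f) n).
  rewrite <- plus_n_O, binom_n_n, Nat.sub_0_r.
  destruct k as [|k]; cbn [prev].
  - rewrite (psum_scal 0). ring.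
  - unfold wcomb at 1.
    rewrite opY_psum, (psum_head _ (S a)).
    rewrite <- plus_n_O, binom_n_n, Nat.sub_0_r.
    change (fun m => words (S a) k f m) with (words (S a) k f).
    change (fun i => Binomial.C (k + S i) k
                     * opY (fun m => words (S a - S i) (k + S i) f m) n)
      with (fun i => Binomial.C (k + S i) k * opY (words (a - i) (k + S i) f) n).
    rewrite (psum_ext (fun i => Binomial.C (k + S i) k * opY (words (a - i) (S k + i) f) n)
      (fun i => Binomial.C (k + S i) k * opY (words (a - i) (k + S i) f) n))
      by (intros; rewrite Nat.add_succ_comm; reflexivity).
    ring.
Qed.

Lemma vterm_wcomb (a k n : nat) : vterm a k n = wcomb (opY delta0) a k n.
Proof.
  revert k n; induction a as [|a IHa]; intros k; induction k as [|k IHk]; intros n;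
    rewrite vterm_rec; cbn [prev vinit].
  - rewrite wcomb_0, words_00. rewrite (opY_ext _ delta0) by (intros; ring).
    unfold opX, Rdiv. ring.
  - rewrite wcomb_0, words_0S.
    rewrite (opY_ext _ (words 0 k (opY delta0)))
      by (intros; rewrite IHk, wcomb_0; ring).
    unfold opX, Rdiv. ring.
  - rewrite wcomb_S. cbn [prev]. f_equal.
    + apply opX_ext. intros; apply IHa.
    + apply opY_ext. intros; rewrite IHa; ring.
  - rewrite wcomb_S. cbn [prev]. f_equal.
    + apply opX_ext. intros; apply IHa.
    + apply opY_ext. intros; rewrite IHa, IHk; ring.
Qed.

(** * Sums of multiple zeta values with last argument 1 *)

(** The part of the nested sum with largest index n. The empty list sits at index 0, so that the
    innermost strict sum equals 1 for n >= 1. *)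
Fixpoint zterm (s : list nat) (n : nat) : R :=
  match s with
  | nil => delta0 n
  | a :: s' => / INR n ^ a * psum (zterm s') n
  end.

Lemma zterm_nonneg (s : list nat) (n : nat) : 0 <= zterm s n.
Proof.
  revert n; induction s as [|a s IH]; intros n; simpl.
  - apply delta0_nonneg.
  - apply Rmult_le_pos; [|apply psum_nonneg, IH].
    rewrite <- pow_inv. apply pow_le, inv_INR_nonneg.
Qed.

Lemma zeta_trunc_psum (N : nat) (s : list nat) :
  Forall (fun a => 1 <= a)%nat s -> zeta_trunc N s = psum (zterm s) (S N).
Proof.
  intros H; revert N; induction H as [|a s Ha Hs IH]; intros N.
  - cbn [zeta_trunc]. rewrite psum_head. simpl.
    rewrite (psum_zero N). ring.
  - cbn [zeta_trunc]. rewrite sum1_psum0.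
    + apply psum_ext. intros [|n] _; cbn [zterm].
      * destruct a as [|a]; [lia|]. simpl. rewrite Rmult_0_l, Rinv_0. ring.
      * rewrite IH. simpl (S n - 1)%nat. rewrite Nat.sub_0_r. reflexivity.
    + destruct a as [|a]; [lia|]. simpl. rewrite Rmult_0_l, Rinv_0. ring.
Qed.

Lemma Rlim_eq (u : nat -> R) (l : R) : Un_cv u l -> Rlim u = l.
Proof.
  intros H. apply (UL_sequence u); [|exact H].
  unfold Rlim. apply epsilon_spec. exists l. exact H.
Qed.

Lemma mzv_eq (s : list nat) (l : R) :
  Forall (fun a => 1 <= a)%nat s -> sums (zterm s) l -> mzv s = l.
Proof.
  intros H C. apply Rlim_eq.
  apply Un_cv_shift1 in C. revert C. apply Un_cv_ext.
  intros N. symmetry. apply zeta_trunc_psum, H.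
Qed.

Definition lsum {A : Type} (l : list A) (f : A -> R) : R := fold_right Rplus 0 (map f l).

Lemma lsum_app {A : Type} (l l' : list A) (f : A -> R) :
  lsum (l ++ l') f = lsum l f + lsum l' f.
Proof.
  unfold lsum. induction l as [|x l IH]; simpl; [ring|]. rewrite IH. ring.
Qed.

Lemma lsum_ext {A : Type} (l : list A) (f g : A -> R) :
  (forall x, In x l -> f x = g x) -> lsum l f = lsum l g.
Proof. intros H. unfold lsum. f_equal. apply map_ext_in, H. Qed.

Lemma lsum_zero {A : Type} (l : list A) (f : A -> R) :
  (forall x, In x l -> f x = 0) -> lsum l f = 0.
Proof.
  intros H. rewrite (lsum_ext l f (fun _ => 0) H). unfold lsum.
  induction l as [|x l IH]; simpl; [reflexivity|].
  rewrite IH; [ring|]. intros y Hy. apply H. right. exact Hy.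
Qed.

Lemma lsum_scal {A : Type} (l : list A) (c : R) (f : A -> R) :
  lsum l (fun x => c * f x) = c * lsum l f.
Proof. unfold lsum. induction l as [|x l IH]; simpl; [|rewrite IH]; ring. Qed.

Lemma lsum_map {A B : Type} (g : A -> B) (l : list A) (f : B -> R) :
  lsum (map g l) f = lsum l (fun x => f (g x)).
Proof. unfold lsum. rewrite map_map. reflexivity. Qed.

Lemma lsum_filter_flat_map {A B : Type} (p : B -> bool) (g : A -> list B) (l : list A)
    (f : B -> R) :
  lsum (filter p (flat_map g l)) f = lsum l (fun a => lsum (filter p (g a)) f).
Proof.
  induction l as [|x l IH]; simpl; [reflexivity|].
  rewrite filter_app, lsum_app, IH. reflexivity.
Qed.

Lemma filter_map_comm {A B : Type} (p : B -> bool) (g : A -> B) (l : list A) :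
  filter p (map g l) = map g (filter (fun x => p (g x)) l).
Proof.
  induction l as [|x l IH]; simpl; [reflexivity|].
  destruct (p (g x)); simpl; rewrite IH; reflexivity.
Qed.

Lemma lsum_psum {A : Type} (l : list A) (f : A -> nat -> R) (N : nat) :
  lsum l (fun x => psum (f x) N) = psum (fun n => lsum l (fun x => f x n)) N.
Proof.
  unfold lsum. induction l as [|x l IH]; simpl; [symmetry; apply psum_zero|].
  rewrite IH, <- psum_plus. reflexivity.
Qed.

(** Convergence of the total forces that of each nonnegative summand, so every [mzv] in the list is
    a genuine limit. *)
Lemma lsum_mzv (l : list (list nat)) (t : R) :
  (forall s, In s l -> Forall (fun a => 1 <= a)%nat s) ->
  sums (fun n => lsum l (fun s => zterm s n)) t -> lsum l mzv = t.
Proof.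
  revert t; induction l as [|s l IH]; intros t H C.
  - exact (sums_unique _ _ _ sums_zero C).
  - destruct (sums_split (zterm s) (fun n => lsum l (fun s => zterm s n)) t)
      as [t1 [t2 [C1 [C2 ->]]]].
    + apply zterm_nonneg.
    + intros n. clear. unfold lsum. induction l as [|s l IH]; simpl; [lra|].
      pose proof (zterm_nonneg s n). lra.
    + exact C.
    + change (lsum (s :: l) mzv) with (mzv s + lsum l mzv).
      rewrite (mzv_eq s t1), (IH t2); auto.
      * intros s' Hs'. apply H. right. exact Hs'.
      * apply H. left. reflexivity.
Qed.

Lemma comps_pos (N d : nat) (s : list nat) :
  In s (comps N d) -> Forall (fun a => 1 <= a)%nat s /\ length s = d.
Proof.
  revert N s; induction d as [|d IH]; intros N s H; cbn [comps] in H.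
  - destruct (Nat.eqb N 0); [|destruct H]. destruct H as [<-|[]]. split; constructor.
  - apply in_flat_map in H as [a [Ha H]]. apply in_map_iff in H as [s' [<- H]].
    apply in_seq in Ha. apply IH in H as [H1 H2]. split.
    + constructor; [lia|exact H1].
    + simpl. rewrite H2. reflexivity.
Qed.

Lemma comps_nil (N d : nat) : (N < d)%nat -> comps N d = nil.
Proof.
  revert N; induction d as [|d IH]; intros N H; [lia|]. cbn [comps].
  assert (E : forall a, In a (seq 1 N) -> map (cons a) (comps (N - a) d) = nil).
  { intros a Ha. apply in_seq in Ha. rewrite IH by lia. reflexivity. }
  revert E. generalize (seq 1 N). intros l. induction l as [|a l IHl]; intros E; [reflexivity|].
  simpl. rewrite E by (left; reflexivity). apply IHl. intros b Hb. apply E. right. exact Hb.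
Qed.

(** No condition on the first argument; the outer X in [SR_eq] raises it by one and so makes it at
    least 2. *)
Definition tau (w d n : nat) : R :=
  lsum (filter (fun s => Nat.eqb (last s 0%nat) 1) (comps w d)) (fun s => zterm s n).

(** [b] is the verdict on the first argument, which lets [tau] and [SR] share the lemma. The tail is
    nonempty, so it keeps the last entry. *)
Lemma lsum_cons_zterm (p : list nat -> bool) (b : bool) (a w d n : nat) :
  (forall s, p (a :: s) = andb b (Nat.eqb (last (a :: s) 0%nat) 1)) ->
  lsum (filter p (map (cons a) (comps w (S d)))) (fun s => zterm s n)
  = if b then / INR n ^ a * psum (tau w (S d)) n else 0.
Proof.
  intros H. rewrite filter_map_comm, lsum_map. cbn [zterm].
  rewrite lsum_scal, lsum_psum.
  rewrite (filter_ext_in (fun x => p (a :: x))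
            (fun x => andb b (Nat.eqb (last x 0%nat) 1))).
  - destruct b; [reflexivity|].
    rewrite (psum_ext _ (fun _ => 0)), psum_zero; [ring|].
    intros m _. apply lsum_zero. intros x Hx. apply filter_In in Hx as [_ Hx].
    discriminate.
  - intros s Hs. rewrite H. apply comps_pos in Hs as [_ Hs].
    destruct s; [discriminate|reflexivity].
Qed.

Lemma lsum_seq_S (w : nat) (f : nat -> R) :
  lsum (seq 1 (S w)) f = f 1%nat + lsum (seq 1 w) (fun a => f (S a)).
Proof.
  cbn [seq]. change (lsum (1%nat :: seq 2 w) f) with (f 1%nat + lsum (seq 2 w) f).
  rewrite <- seq_shift, lsum_map. reflexivity.
Qed.

Lemma tau_SS (w d n : nat) :
  tau w (S (S d)) n = lsum (seq 1 w) (fun a => / INR n ^ a * psum (tau (w - a) (S d)) n).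
Proof.
  unfold tau at 1. remember (S d) as d' eqn:Ed. cbn [comps]. subst d'.
  rewrite lsum_filter_flat_map. apply lsum_ext. intros a _.
  apply (lsum_cons_zterm _ true). reflexivity.
Qed.

(** A first argument 1 is a letter Y; a larger one loses an X. Depth at least 2 keeps the last
    argument untouched. *)
Lemma tau_rec (w d n : nat) :
  tau (S w) (S (S d)) n = opY (tau w (S d)) n + opX (tau w (S (S d))) n.
Proof.
  rewrite tau_SS, lsum_seq_S. unfold opX. rewrite tau_SS.
  cbn [Nat.sub]. rewrite Nat.sub_0_r. f_equal.
  - unfold opY, Rdiv. simpl. rewrite Rmult_1_r. ring.
  - unfold Rdiv. rewrite Rmult_comm, <- lsum_scal. apply lsum_ext. intros a _.
    simpl pow. rewrite Rinv_mult. ring.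
Qed.

Lemma tau_lt (w d n : nat) : (w < d)%nat -> tau w d n = 0.
Proof. intros H. unfold tau. rewrite comps_nil by exact H. reflexivity. Qed.

Lemma tau_1_1 (n : nat) : tau 1 1 n = opY delta0 n.
Proof.
  change (/ INR n ^ 1 * psum delta0 n + 0 = opY delta0 n).
  unfold opY, Rdiv. rewrite pow_1. ring.
Qed.

Lemma tau_SS_1 (w n : nat) : tau (S (S w)) 1 n = 0.
Proof.
  apply lsum_zero. intros s Hs. exfalso. apply filter_In in Hs as [Hs Hl].
  cbn [comps] in Hs. apply in_flat_map in Hs as [a [Ha Hs]].
  apply in_map_iff in Hs as [s' [<- Hs]]. destruct (Nat.eqb_spec (S (S w) - a) 0); [|destruct Hs].
  destruct Hs as [<-|[]]. apply in_seq in Ha. apply Nat.eqb_eq in Hl. simpl in Hl. lia.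
Qed.

(** An argument c is the block X^(c-1) Y; a last argument 1 means that the two innermost letters are
    Y Y. *)
Lemma tau_words (a d n : nat) :
  tau (a + d + 2) (d + 2) n = words a d (opY (opY delta0)) n.
Proof.
  replace (d + 2)%nat with (S (S d)) by lia.
  replace (a + d + 2)%nat with (S (S (a + d))) by lia.
  revert d n; induction a as [|a IHa]; intros d; induction d as [|d IHd]; intros n;
    rewrite tau_rec.
  - simpl (0 + 0)%nat. rewrite words_00, (opY_ext _ _ n tau_1_1).
    unfold opX. rewrite tau_lt by lia. unfold Rdiv. ring.
  - rewrite words_0S. rewrite (opY_ext (tau (S (0 + S d)) (S (S d))) _ n IHd).
    unfold opX. rewrite tau_lt by lia. unfold Rdiv. ring.
  - rewrite words_S0. rewrite (opX_ext (tau (S (S a + 0)) 2) _ n (IHa O)).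
    rewrite (opY_ext _ (fun _ => 0)) by (intros; apply tau_SS_1).
    unfold opY. rewrite psum_zero. unfold Rdiv. ring.
  - rewrite words_SS. unfold fadd. rewrite Rplus_comm. f_equal.
    + simpl (S a + S d)%nat. apply opX_ext, IHa.
    + rewrite <- plus_n_Sm. apply opY_ext, IHd.
Qed.

Lemma SR_eq (a d : nat) (t : R) :
  sums (opX (words a d (opY (opY delta0)))) t -> SR (a + d + 3) (d + 2) = t.
Proof.
  intros H. apply lsum_mzv.
  - intros s Hs. apply filter_In in Hs as [Hs _]. apply comps_pos in Hs. apply Hs.
  - revert H. apply sums_ext. intros n.
    rewrite <- (opX_ext _ _ n (tau_words a d)).
    replace (a + d + 3)%nat with (S (a + d + 2)) by lia.
    replace (d + 2)%nat with (S (S d)) by lia.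
    remember (a + d + 2)%nat as w. clear.
    remember (S d) as d' eqn:Ed. cbn [comps]. subst d'.
    rewrite lsum_filter_flat_map, lsum_seq_S, (lsum_cons_zterm _ false) by reflexivity.
    rewrite Rplus_0_l. unfold opX. rewrite tau_SS.
    unfold Rdiv. rewrite Rmult_comm, <- lsum_scal. apply lsum_ext. intros b Hb.
    apply in_seq in Hb.
    rewrite (lsum_cons_zterm _ true).
    + simpl pow. rewrite Rinv_mult. cbn [Nat.sub]. ring.
    + intros s. simpl hd. destruct b; [lia|]. reflexivity.
Qed.

(** * The polynomials P and Q at harmonic numbers *)

(** The sign of P amounts to replacing y_i by (-1)^(i-1) y_i in Q, so one argument handles both. *)
Definition pcoef (alt : bool) (y : nat -> R) (i : nat) : R :=
  if andb alt (Nat.even i) then - y i else y i.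

Definition expo (alt : bool) (y : nat -> R) (i x : nat) : R :=
  (pcoef alt y i / INR i) ^ x / INR (fact x).

Lemma pterm_cons (alt : bool) (i : nat) (y : nat -> R) (x : nat) (m : list nat) :
  pterm alt i y (x :: m) = expo alt y i x * pterm alt (S i) y m.
Proof.
  cbn [pterm]. unfold expo, pcoef. destruct (andb alt (Nat.even i)).
  - replace (- y i / INR i) with (-1 * (y i / INR i)) by (unfold Rdiv; ring).
    rewrite Rpow_mult_distr. unfold Rdiv. ring.
  - unfold Rdiv. ring.
Qed.

(* The coefficient of [t^n] in the product over [i <= j < i + L] of
   [exp (pcoef j * t^j / j)], each exponential being truncated at order [B]. The
   weight is an integer so that [n - j] needs no side condition. *)
Definition gsum (alt : bool) (y : nat -> R) (B i L : nat) (n : Z) : R :=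
  lsum (tuples L B)
    (fun m => if Z.eqb (Z.of_nat (wsum i m)) n then pterm alt i y m else 0).

Lemma lsum_flat_map {A B : Type} (g : A -> list B) (l : list A) (f : B -> R) :
  lsum (flat_map g l) f = lsum l (fun a => lsum (g a) f).
Proof.
  induction l as [|x l IH]; simpl; [reflexivity|]. rewrite lsum_app, IH. reflexivity.
Qed.

Lemma lsum_seq0 (f : nat -> R) (N : nat) : lsum (seq 0 N) f = psum f N.
Proof.
  induction N as [|N IH]; [reflexivity|].
  rewrite seq_S, lsum_app, IH. unfold lsum. simpl. ring.
Qed.

Lemma gsum_0 (alt : bool) (y : nat -> R) (B i : nat) (n : Z) :
  gsum alt y B i 0 n = if Z.eqb 0 n then 1 else 0.
Proof. unfold gsum, lsum. simpl. ring. Qed.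

Lemma gsum_S (alt : bool) (y : nat -> R) (B i L : nat) (n : Z) :
  gsum alt y B i (S L) n
  = psum (fun x => expo alt y i x * gsum alt y B (S i) L (n - Z.of_nat (i * x))) (S B).
Proof.
  unfold gsum. cbn [tuples]. rewrite lsum_flat_map, lsum_seq0.
  apply psum_ext. intros x _. rewrite lsum_map, <- lsum_scal.
  apply lsum_ext. intros m _. rewrite pterm_cons. cbn [wsum].
  destruct (Z.eqb_spec (Z.of_nat (i * x + wsum (S i) m)) n);
    destruct (Z.eqb_spec (Z.of_nat (wsum (S i) m)) (n - Z.of_nat (i * x)));
    try lia; ring.
Qed.

Lemma gsum_neg (alt : bool) (y : nat -> R) (B i L : nat) (n : Z) :
  (n < 0)%Z -> gsum alt y B i L n = 0.
Proof.
  intros H. apply lsum_zero. intros m _.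
  destruct (Z.eqb_spec (Z.of_nat (wsum i m)) n); [lia|reflexivity].
Qed.

Lemma gsum_zero_weight (alt : bool) (y : nat -> R) (B i L : nat) :
  (1 <= i)%nat -> gsum alt y B i L 0 = 1.
Proof.
  revert i; induction L as [|L IH]; intros i Hi; [apply gsum_0|].
  rewrite gsum_S, psum_head, Nat.mul_0_r. simpl (0 - Z.of_nat 0)%Z. rewrite IH by lia.
  rewrite (psum_ext _ (fun _ => 0)), psum_zero.
  - unfold expo. simpl. field.
  - intros x _. rewrite gsum_neg by nia. ring.
Qed.

Lemma expo_S (alt : bool) (y : nat -> R) (i x : nat) :
  (1 <= i)%nat ->
  INR (i * S x) * expo alt y i (S x) = pcoef alt y i * expo alt y i x.
Proof.
  intros Hi. unfold expo. rewrite fact_simpl, !mult_INR. simpl pow. field.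
  repeat split; try apply INR_fact_neq_0; apply not_0_INR; lia.
Qed.

(* Newton's identity, the logarithmic derivative of the product of exponentials. *)
Lemma gsum_newton (alt : bool) (y : nat -> R) (B i L : nat) (n : Z) :
  (1 <= i)%nat -> (n <= Z.of_nat B)%Z ->
  IZR n * gsum alt y B i L n
  = psum (fun j => pcoef alt y (i + j) * gsum alt y B i L (n - Z.of_nat (i + j))) L.
Proof.
  revert i n; induction L as [|L IH]; intros i n Hi Hn.
  { rewrite gsum_0. cbn [psum]. destruct (Z.eqb_spec 0 n); [subst|]; ring. }
  set (G := fun n => gsum alt y B (S i) L n).
  set (E := expo alt y i). set (c := pcoef alt y).
  (* The factor n is split as i x + (n - i x): the first part differentiates the leading
     exponential, the second goes to the induction hypothesis. *)
  assert (D : IZR n * gsum alt y B i (S L) n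
    = psum (fun x => INR (i * x) * E x * G (n - Z.of_nat (i * x))%Z) (S B)
      + psum (fun x => E x * (IZR (n - Z.of_nat (i * x)) * G (n - Z.of_nat (i * x))%Z)) (S B)).
  { rewrite gsum_S, <- psum_scal, <- psum_plus. apply psum_ext. intros x _.
    rewrite minus_IZR, <- INR_IZR_INZ. unfold E, G. ring. }
  rewrite D, psum_head. clear D.
  assert (D1 : psum (fun x => INR (i * S x) * E (S x) * G (n - Z.of_nat (i * S x))%Z) B
               = c i * gsum alt y B i (S L) (n - Z.of_nat i)).
  { rewrite gsum_S, <- psum_scal. cbn [psum]. rewrite (gsum_neg _ _ _ _ _ (_ - _ - _)) by nia.
    rewrite Rmult_0_r, Rmult_0_r, Rplus_0_r. apply psum_ext. intros x _.
    unfold E. rewrite expo_S by exact Hi. fold (c i).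
    replace (n - Z.of_nat (i * S x))%Z with (n - Z.of_nat i - Z.of_nat (i * x))%Z by nia.
    unfold G. ring. }
  rewrite D1. clear D1.
  rewrite (psum_ext (fun x => E x * _)
    (fun x => psum (fun j => E x * (c (S i + j)%nat
               * G (n - Z.of_nat (S i + j) - Z.of_nat (i * x))%Z)) L)).
  2:{ intros x _. unfold G at 1. rewrite IH by lia. rewrite psum_scal. f_equal.
      apply psum_ext. intros j _. unfold G, c. do 2 f_equal. lia. }
  rewrite psum_swap, (psum_head _ L), Nat.mul_0_r, Nat.add_0_r.
  fold c. simpl (INR 0).
  rewrite (psum_ext (fun j => psum _ (S B))
    (fun j => c (i + S j)%nat * gsum alt y B i (S L) (n - Z.of_nat (i + S j)))).
  2:{ intros j _. rewrite gsum_S, <- psum_scal. apply psum_ext. intros x _.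
      unfold E, G. rewrite <- plus_n_Sm. simpl (S i + j)%nat. ring. }
  ring.
Qed.

Lemma psum_trunc (f : nat -> R) (n N : nat) :
  (n <= N)%nat -> (forall j, (n <= j)%nat -> f j = 0) -> psum f N = psum f n.
Proof.
  intros H F. induction H as [|N H IH]; [reflexivity|]. simpl. rewrite IH, F by lia. ring.
Qed.

(** Newton's recurrence and t_0 = 1 determine the sequence. The bound N stays fixed while n varies,
    since [mults n] ties both to the same number. *)
Lemma gsum_unique (alt : bool) (y t : nat -> R) (N n : nat) :
  t O = 1 ->
  (forall n, INR n * t n = psum (fun j => pcoef alt y (S j) * t (n - S j)%nat) n) ->
  (n <= N)%nat -> gsum alt y N 1 N (Z.of_nat n) = t n.
Proof.
  intros T0 T. induction n as [n IH] using (well_founded_induction lt_wf). intros Hn.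
  destruct n as [|n]; [rewrite T0; apply gsum_zero_weight; lia|].
  apply Rmult_eq_reg_l with (INR (S n)); [|apply not_0_INR; lia].
  rewrite T, INR_IZR_INZ, gsum_newton by lia.
  rewrite (psum_trunc _ (S n)); [|exact Hn|].
  - apply psum_ext. intros j Hj. simpl (1 + j)%nat. f_equal.
    rewrite <- IH by lia. f_equal. lia.
  - intros j Hj. rewrite gsum_neg by lia. ring.
Qed.

Lemma lsum_mults (n : nat) (alt : bool) (y : nat -> R) :
  lsum (mults n) (pterm alt 1 y) = gsum alt y n 1 n (Z.of_nat n).
Proof.
  unfold gsum, mults. generalize (tuples n n). intros l.
  induction l as [|m l IH]; [reflexivity|].
  change (lsum (m :: l) ?f) with (f m + lsum l f). cbn beta. rewrite <- IH. simpl filter.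
  destruct (Nat.eqb_spec (wsum 1 m) n); destruct (Z.eqb_spec (Z.of_nat (wsum 1 m)) (Z.of_nat n));
    try lia; [reflexivity|ring].
Qed.

(** * Newton's identities for h_a and e_k in 1, 1/2, ..., 1/m *)

Lemma Hr_S (m r : nat) : Hr (S m) r = Hr m r + (/ INR (S m)) ^ r.
Proof. unfold Hr. cbn [sum1]. rewrite pow_inv. reflexivity. Qed.

(** Adding the variable z = 1/(m+1) adds z^j to the power sums. As [HS] keeps m+1 variables in the
    lower term, an inner induction on a is needed. *)
Lemma hsym_newton (m a : nat) :
  INR a * hsym 0 a m = psum (fun j => Hr m (S j) * hsym 0 (a - S j) m) a.
Proof.
  revert a; induction m as [|m IHm]; intros a.
  { rewrite (psum_ext _ (fun _ => 0)), psum_zero.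
    - destruct a; simpl; ring.
    - intros j _. unfold Hr. simpl. ring. }
  set (z := / INR (S m)).
  assert (HS : forall a, hsym 0 (S a) (S m) = hsym 0 (S a) m + z * hsym 0 a (S m)).
  { intros b. rewrite (hsym_S 0 (S b) m). cbn [prev]. unfold z, Rdiv.
    simpl (0 + S m)%nat. ring. }
  induction a as [|a IHa]; [simpl; ring|].
  rewrite (psum_ext _ (fun j => Hr m (S j) * hsym 0 (a - j) (S m)
                                + z ^ S j * hsym 0 (a - j) (S m)))
    by (intros; rewrite Hr_S; cbn [Nat.sub]; fold z; ring).
  rewrite psum_plus.
  assert (E1 : psum (fun j => Hr m (S j) * hsym 0 (a - j) (S m)) (S a)
    = psum (fun j => Hr m (S j) * hsym 0 (S a - S j) m) (S a)
      + z * psum (fun j => Hr m (S j) * hsym 0 (a - S j) (S m)) a).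
  { cbn [psum Nat.sub]. rewrite Nat.sub_diag.
    rewrite (psum_ext _ (fun j => Hr m (S j) * hsym 0 (a - j) m
      + z * (Hr m (S j) * hsym 0 (a - S j) (S m))) a).
    - rewrite psum_plus, psum_scal. simpl hsym. ring.
    - intros j Hj. replace (a - j)%nat with (S (a - S j)) by lia. rewrite HS. ring. }
  assert (E2 : psum (fun j => z ^ S j * hsym 0 (a - j) (S m)) (S a)
    = z * hsym 0 a (S m) + z * psum (fun j => z ^ S j * hsym 0 (a - S j) (S m)) a).
  { rewrite psum_head, Nat.sub_0_r, <- psum_scal. f_equal; [simpl; ring|].
    apply psum_ext. intros j _. simpl pow. ring. }
  rewrite E1, E2, <- IHm, HS, Rmult_plus_distr_l.
  rewrite (psum_ext _ (fun j => Hr m (S j) * hsym 0 (a - S j) (S m)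
                                + z ^ S j * hsym 0 (a - S j) (S m))) in IHa
    by (intros; rewrite Hr_S; fold z; ring).
  rewrite psum_plus in IHa. rewrite (S_INR a) at 2.
  transitivity (INR (S a) * hsym 0 (S a) m + z * hsym 0 a (S m)
                + z * (INR a * hsym 0 a (S m))); [ring|].
  rewrite IHa. ring.
Qed.

Definition sgn (j : nat) : R := if Nat.even (S j) then -1 else 1.

Lemma sgn_S (j : nat) : sgn (S j) = - sgn j.
Proof.
  unfold sgn. rewrite (Nat.even_succ (S j)), <- Nat.negb_even.
  destruct (Nat.even (S j)); simpl; ring.
Qed.

Lemma esym_newton (m k : nat) :
  INR k * esym k m = psum (fun j => sgn j * Hr m (S j) * esym (k - S j) m) k.
Proof.
  revert k; induction m as [|m IHm]; intros k.
  { rewrite (psum_ext _ (fun _ => 0)), psum_zero.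
    - destruct k; simpl; ring.
    - intros j _. unfold Hr. simpl. ring. }
  set (z := / INR (S m)).
  assert (ES : forall k, esym (S k) (S m) = esym (S k) m + z * esym k m).
  { intros b. rewrite (esym_S (S b) m). cbn [prev]. unfold z, Rdiv. ring. }
  destruct k as [|k]; [simpl; ring|].
  rewrite (psum_ext _ (fun j => sgn j * Hr m (S j) * esym (k - j) (S m)
                                + sgn j * z ^ S j * esym (k - j) (S m)))
    by (intros; rewrite Hr_S; cbn [Nat.sub]; fold z; ring).
  rewrite psum_plus.
  assert (E1 : psum (fun j => sgn j * Hr m (S j) * esym (k - j) (S m)) (S k)
    = psum (fun j => sgn j * Hr m (S j) * esym (S k - S j) m) (S k)
      + z * psum (fun j => sgn j * Hr m (S j) * esym (k - S j) m) k).
  { cbn [psum Nat.sub]. rewrite Nat.sub_diag.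
    rewrite (psum_ext _ (fun j => sgn j * Hr m (S j) * esym (k - j) m
      + z * (sgn j * Hr m (S j) * esym (k - S j) m)) k).
    - rewrite psum_plus, psum_scal. simpl esym. ring.
    - intros j Hj. replace (k - j)%nat with (S (k - S j)) by lia. rewrite ES. ring. }
  (* Dividing the generating function of e in m+1 variables by 1 + z t removes the variable z. *)
  assert (E2 : psum (fun j => sgn j * z ^ S j * esym (k - j) (S m)) (S k) = z * esym k m).
  { assert (R : forall k, psum (fun j => sgn j * z ^ S j * esym (k - j) (S m)) (S k)
      = z * esym k (S m) - z * psum (fun j => sgn j * z ^ S j * esym (k - S j) (S m)) k).
    { intros b. rewrite psum_head, Nat.sub_0_r.
      replace (z * esym b (S m) - z * psum (fun j => sgn j * z ^ S j * esym (b - S j) (S m)) b)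
        with (z * esym b (S m)
              + (- z) * psum (fun j => sgn j * z ^ S j * esym (b - S j) (S m)) b) by ring.
      rewrite <- psum_scal. f_equal; [change (sgn 0) with 1; ring|].
      apply psum_ext. intros j _. rewrite sgn_S. simpl pow. ring. }
    clear E1. induction k as [|k IHk]; rewrite R.
    - simpl. ring.
    - cbn [Nat.sub]. rewrite IHk, ES. ring. }
  rewrite E1, E2, <- !IHm, ES, (S_INR k). ring.
Qed.

Lemma Qpoly_Hr (l n : nat) : Qpoly l (fun i => Hr n i) = hsym 0 l n.
Proof.
  change (lsum (mults l) (pterm false 1 (fun i => Hr n i)) = hsym 0 l n).
  rewrite lsum_mults.
  apply (gsum_unique false _ (fun a => hsym 0 a n)); [reflexivity| |lia].
  intros a. apply hsym_newton.
Qed.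

Lemma Ppoly_Hr (k n : nat) : Ppoly k (fun i => Hr n i) = esym k n.
Proof.
  change (lsum (mults k) (pterm true 1 (fun i => Hr n i)) = esym k n).
  rewrite lsum_mults.
  apply (gsum_unique true _ (fun b => esym b n)); [reflexivity| |lia].
  intros b. rewrite esym_newton. apply psum_ext. intros j _.
  unfold sgn, pcoef. cbn [andb]. destruct (Nat.even (S j)); ring.
Qed.

(** * The summation formula *)

Lemma sums_inv_pow_cv (N : nat) :
  (2 <= N)%nat -> exists s, sums (fun n => / INR (S n) ^ N) s.
Proof.
  intros HN.
  (* The factor 2 comes from x + 1 <= 2 x for x >= 1. *)
  apply (sums_dominated _ (fun n => 2 * (/ INR (S n) - / INR (S (S n)))) (2 * / INR 1)).
  - intros n. pose proof (INR_S_pos n) as P. rewrite (S_INR (S n)).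
    assert (P1 : 1 <= INR (S n)) by (apply (le_INR 1); lia).
    split.
    + apply Rlt_le, Rinv_0_lt_compat, pow_lt, P.
    + apply Rle_trans with (/ INR (S n) ^ 2).
      * apply Rinv_le_contravar; [apply pow_lt, P|]. apply Rle_pow; assumption.
      * remember (INR (S n)) as x.
        replace (2 * (/ x - / (x + 1))) with (2 * / (x * (x + 1))) by (field; lra).
        replace (/ x ^ 2) with (2 * / (x * (2 * x))) by (field; lra).
        apply Rmult_le_compat_l; [lra|]. apply Rinv_le_contravar; nra.
  - apply sums_scal, (sums_telescope (fun n => / INR (S n))), Un_cv_inv_S.
Qed.

Lemma mzv_depth1 (N : nat) :
  (2 <= N)%nat -> sums (fun n => / INR (S n) ^ N) (mzv (N :: nil)).
Proof.
  intros HN. destruct (sums_inv_pow_cv N HN) as [s Hs].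
  replace (mzv (N :: nil)) with s; [exact Hs|]. symmetry. apply mzv_eq.
  - constructor; [lia|constructor].
  - apply sums_shift1; [simpl; ring|]. revert Hs. apply sums_ext. intros n.
    change (/ INR (S n) ^ N = / INR (S n) ^ N * psum delta0 (S n)).
    rewrite psum_head. simpl delta0. rewrite psum_zero. ring.
Qed.

Lemma sums_opX_vterm (a b : nat) :
  sums (opX (vterm a b))
    (Binomial.C (a + b + 1) (b + 1) * mzv ((a + b + 2)%nat :: nil)).
Proof.
  apply sums_shift1; [apply opX_0|].
  apply sums_ext with (fun n => ucoef 0 n a b / INR (S n)).
  - intros n. unfold ucoef. rewrite kern_0_l. simpl (0 + n)%nat. unfold opX. cbn [vterm].
    pose proof (INR_S_pos n). field. lra.
  - apply sums_ucoef. unfold Rdiv. apply (sums_scal _ (fun n => / INR (S n) ^ _)).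
    apply mzv_depth1. lia.
Qed.

Lemma opX_le (f g : nat -> R) (n : nat) : (forall m, f m <= g m) -> opX f n <= opX g n.
Proof. intros H. apply Rmult_le_compat_r; [apply inv_INR_nonneg|apply H]. Qed.

Lemma opX_le_id (f : nat -> R) (n : nat) : (forall m, 0 <= f m) -> opX f n <= f n.
Proof.
  intros H. destruct n as [|n]; [rewrite opX_0; apply H|].
  unfold opX, Rdiv. rewrite <- (Rmult_1_r (f (S n))) at 2.
  apply Rmult_le_compat_l; [apply H|]. rewrite <- Rinv_1.
  apply Rinv_le_contravar; [lra|]. apply (le_INR 1). lia.
Qed.

Lemma binom_nonneg (n k : nat) : 0 <= Binomial.C n k.
Proof.
  unfold Binomial.C. apply Rlt_le, Rdiv_lt_0_compat; [apply INR_fact_pos|].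
  apply Rmult_lt_0_compat; apply INR_fact_pos.
Qed.

(** This is the term i = 0 of [wcomb], with coefficient 1. It gives the domination from which the
    convergence of the S^R follows. *)
Lemma words_le_vterm (a b n : nat) : words a b (opY delta0) n <= vterm a b n.
Proof.
  assert (W : forall a b n, 0 <= words a b (opY delta0) n).
  { intros. apply words_nonneg. intros. apply opY_nonneg, delta0_nonneg. }
  rewrite vterm_wcomb. unfold wcomb. rewrite psum_head.
  rewrite <- plus_n_O, binom_n_n, Nat.sub_0_r, Rmult_1_l.
  rewrite <- (Rplus_0_r (words a b (opY delta0) n)) at 1.
  apply Rplus_le_compat_l, psum_nonneg. intros i.
  apply Rmult_le_pos; [apply binom_nonneg|apply W].
Qed.

Lemma sums_words_SR (a b : nat) :
  sums (opX (opX (words a b (opY delta0)))) (SR (b + a + 3) (a + 2)).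
Proof.
  assert (W : forall n, 0 <= words a b (opY delta0) n).
  { intros. apply words_nonneg. intros. apply opY_nonneg, delta0_nonneg. }
  destruct (fun H => sums_dominated (opX (opX (words a b (opY delta0)))) _ _ H
              (sums_opX_vterm a b)) as [t Ht].
  - intros n. split.
    + apply opX_nonneg. intros. apply opX_nonneg, W.
    + apply opX_le. intros m. apply Rle_trans with (1 := opX_le_id _ m W).
      apply words_le_vterm.
  - rewrite (SR_eq b a t); [exact Ht|]. apply words_duality, Ht.
Qed.

Lemma sums_opX_opX_vterm (a k : nat) :
  sums (opX (opX (vterm a k)))
    (psum (fun i => Binomial.C (k + i) k * SR (k + a + 3) (a - i + 2)) (S a)).
Proof.
  apply sums_ext with (fun n => psum (fun i => Binomial.C (k + i) k
    * opX (opX (words (a - i) (k + i) (opY delta0))) n) (S a)).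
  - intros n. rewrite <- (opX_psum _ (fun i => opX (words (a - i) (k + i) (opY delta0)))).
    apply opX_ext. intros m.
    rewrite <- (opX_psum _ (fun i => words (a - i) (k + i) (opY delta0))).
    apply opX_ext. intros p. symmetry. apply vterm_wcomb.
  - apply sums_psum. intros i Hi. apply sums_scal.
    replace (k + a + 3)%nat with (k + i + (a - i) + 3)%nat by lia.
    apply sums_words_SR.
Qed.

Theorem mainTheorem18 (l k : nat) :
  infinite_sum
    (fun n => Qpoly l (fun i => Hr n i) * Ppoly k (fun i => Hr n i)
              / (INR n + 1) ^ 2)
    (Binomial.C (l + k + 1) (k + 1) * mzv ((l + k + 2)%nat :: nil)
     - sum1 l (fun j => let p := (k + j - 1)%nat in
                        Binomial.C p k * SR (l + k + 2) (l + k + 1 - p))).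
Proof.
  set (f := fun n => _) at 1. set (s := _ - _).
  assert (H : sums f s).
  { unfold f, s. pose proof (sums_opX_vterm l k) as V.
    apply sums_shift1 in V; [|apply opX_0].
    destruct l as [|a].
    - simpl sum1. rewrite Rminus_0_r. revert V. apply sums_ext. intros n.
      rewrite Qpoly_Hr, Ppoly_Hr. unfold opX. cbn [vterm hsym]. rewrite <- S_INR.
      pose proof (INR_S_pos n). field. lra.
    - pose proof (sums_opX_opX_vterm a k) as W.
      apply sums_shift1 in W; [|apply opX_0].
      apply (sums_scal (-1)) in W. pose proof (sums_plus _ _ _ _ V W) as T.
      rewrite sum1_psum.
      replace (psum (fun n => _) (S a)) with
        (psum (fun i => Binomial.C (k + i) k * SR (k + a + 3) (a - i + 2)) (S a)).
      + replace (_ - _) with (Binomial.C (S a + k + 1) (k + 1) * mzv ((S a + k + 2)%nat :: nil)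
          + -1 * psum (fun i => Binomial.C (k + i) k * SR (k + a + 3) (a - i + 2)) (S a)) by ring.
        revert T. apply sums_ext. intros n.
        rewrite Qpoly_Hr, Ppoly_Hr. unfold opX. cbn [vterm]. rewrite <- S_INR.
        rewrite (hsym_S 0 (S a) n). cbn [prev]. simpl (0 + S n)%nat.
        pose proof (INR_S_pos n). field. lra.
      + apply psum_ext. intros i Hi. cbv zeta.
        replace (k + S i - 1)%nat with (k + i)%nat by lia.
        replace (S a + k + 2)%nat with (k + a + 3)%nat by lia.
        replace (S a + k + 1 - (k + i))%nat with (a - i + 2)%nat by lia.
        reflexivity. }
  (* [sum_f_R0] includes its upper index, hence the shift by one. *)
  apply Un_cv_shift1 in H. revert H. apply Un_cv_ext.
  intros N. symmetry. apply sum_f_R0_psum.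
Qed.
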